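(* Let $N$ be a group with identity $e$ and let $A=\bigoplus_{n\in N}A_n$ be an $N$-crossed product quasi-Hopf algebra over a field $\Bbbk$, with a fixed choice of homogeneous units $u_n\in A_n$ ($n\in N$) such that $u_e=1$ and $\varepsilon(u_n)=1$ for all $n\in N$. For $n,m\in N$ and $b\in A_e$ put $\varphi_n(b)=u_nbu_n^{-1}$ and $\sigma(n,m)=u_nu_mu_{nm}^{-1}$. Assume that $\varphi_n=\mathrm{id}_{A_e}$ for all $n\in N$ and that $\sigma(n,m)\in G_{\mathrm c}(A_e)$ for all $n,m\in N$. Then $\sigma$ is a normalized $2$-cocycle of $N$ with values in $G_{\mathrm c}(A_e)$ (trivial action), with class $[\sigma]\in H^2(N,G_{\mathrm c}(A_e))$, and: (i) Algebra retractions $\tau\colon A\to A_e$ (algebra morphisms with $\tau|_{A_e}=\mathrm{id}_{A_e}$) such that $\tau(u_n)\in G_{\mathrm c}(A_e)$ for all $n\in N$ are in bijective correspondence, via $\gamma(n)=\tau(u_n)$, with the maps $\gamma\colon N\to G_{\mathrm c}(A_e)$ satisfying $\gamma(e)=1$ and \[ \sigma(n,m)=\gamma(n)\gamma(m)\gamma(nm)^{-1},\qquad n,m\in N. \] (ii) If $[\sigma]\neq1$ in $H^2(N,G_{\mathrm c}(A_e))$, the set of such retractions is empty. If $[\sigma]=1$, it is a torsor under the group $\mathrm{Hom}(N,G_{\mathrm c}(A_e))$, acting by pointwise multiplication on $\gamma$.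
   Context: Conventions. $\Bbbk$ is a field; vector spaces, algebras and tensor products are over $\Bbbk$; algebras are unital and algebra (anti-)morphisms preserve units. Summation is suppressed: $\Delta(x)=x'\otimes x''$, $\Phi=\Phi^{(1)}\otimes\Phi^{(2)}\otimes\Phi^{(3)}$, $\Phi^{-1}=\Phi^{(-1)}\otimes\Phi^{(-2)}\otimes\Phi^{(-3)}$. Quasi-Hopf algebras. A quasi-Hopf algebra is an algebra $A$ with algebra morphisms $\Delta\colon A\to A\otimes A$, $\varepsilon\colon A\to\Bbbk$, an invertible $\Phi\in A^{\otimes 3}$, an algebra anti-morphism $S\colon A\to A$ (not assumed bijective) and elements $\alpha,\beta\in A$ such that for all $x\in A$: $(1\otimes\Phi)(\mathrm{id}\otimes\Delta\otimes\mathrm{id})(\Phi)(\Phi\otimes1)=(\mathrm{id}\otimes\mathrm{id}\otimes\Delta)(\Phi)(\Delta\otimes\mathrm{id}\otimes\mathrm{id})(\Phi)$; $\Phi(\Delta\otimes\mathrm{id})(\Delta(x))=(\mathrm{id}\otimes\Delta)(\Delta(x))\Phi$; $(\mathrm{id}\otimes\varepsilon\otimes\mathrm{id})(\Phi)=1\otimes1$; $(\mathrm{id}\otimes\varepsilon)\Delta(x)=x=(\varepsilon\otimes\mathrm{id})\Delta(x)$; $S(x')\alpha x''=\varepsilon(x)\alpha$; $x'\beta S(x'')=\varepsilon(x)\beta$; $\Phi^{(1)}\beta S(\Phi^{(2)})\alpha\Phi^{(3)}=1=S(\Phi^{(-1)})\alpha\Phi^{(-2)}\beta S(\Phi^{(-3)})$.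 Throughout, $(\alpha,\beta)$ is normalized by $\varepsilon(\alpha)=\varepsilon(\beta)=1$. Gradings. An $N$-graded quasi-Hopf algebra is a quasi-Hopf algebra with a vector space decomposition $A=\bigoplus_{n\in N}A_n$ such that $A_nA_m\subseteq A_{nm}$, $\Delta(A_n)\subseteq A_n\otimes A_n$, $S(A_n)\subseteq A_{n^{-1}}$, $\Phi\in A_e^{\otimes3}$, $\alpha,\beta\in A_e$; then $A_e$ is a quasi-Hopf algebra with the restricted structure. It is an $N$-crossed product if every $A_n$ contains a unit of $A$. An element $x$ of a quasi-Hopf algebra $B$ is group-like if $\Delta(x)=x\otimes x$ and $\varepsilon(x)=1$; $G_{\mathrm c}(B)$ is the abelian group (under multiplication) of invertible central group-like elements of $B$. $H^2(N,M)$ denotes group cohomology with trivial action, written multiplicatively. *)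

(* Defs.v *)
From HB Require Import structures.
From mathcomp Require Import all_boot all_order all_algebra.
From mathcomp Require Import sesquilinear boolp classical_sets.

Set Implicit Arguments.
Unset Strict Implicit.
Unset Printing Implicit Defensive.

Import GRing.Theory.
Local Open Scope ring_scope.
Local Open Scope quotient_scope.

Notation bilinear_map f := (bilinear_for *:%R *:%R f).

Section Tensor.
Variables (k : fieldType) (U V : algType k).
Implicit Types (s t : seq (U * V)) (W : lmodType k).

Definition feval W (f : U -> V -> W) s : W := \sum_(p <- s) f p.1 p.2.

(* Two formal sums of pure tensors are identified when no bilinear map, with
   values in any vector space, separates them. By the universal property this is
   the quotient of the free space on U * V by the bilinearity relations. *)
Definition tensor_eq : rel (seq (U * V)) := fun s t =>
  `[< forall (W : lmodType k) (f : U -> V -> W), bilinear_map f ->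
      feval f s = feval f t >].

Lemma tensor_eq_equiv : equiv_class_of tensor_eq.
Proof.
split=> [s|s t|t s r] /=.
- by apply/asboolP.
- by apply/asboolP/asboolP => H W f /H.
- move=> /asboolP st /asboolP tr; apply/asboolP => W f Hf.
  by rewrite st // tr.
Qed.
Canonical tensor_eq_equiv_rel := EquivRelPack tensor_eq_equiv.

Definition tensor := {eq_quot tensor_eq}.
HB.instance Definition _ := Choice.on tensor.
HB.instance Definition _ := EqQuotient.on tensor.

Definition pure (u : U) (v : V) : tensor := \pi_tensor [:: (u, v)].

(* For bilinear f this is the induced linear map; see tlift_pure. *)
Definition tlift W (f : U -> V -> W) (x : tensor) : W := feval f (repr x).

Lemma fevalcat W (f : U -> V -> W) s t :
  feval f (s ++ t) = feval f s + feval f t.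
Proof. by rewrite /feval big_cat. Qed.

Definition fscale (a : k) s : seq (U * V) := [seq (a *: p.1, p.2) | p <- s].

Lemma fevalscale W (f : U -> V -> W) a s : bilinear_map f ->
  feval f (fscale a s) = a *: feval f s.
Proof.
move=> Hf; rewrite /feval /fscale big_map scaler_sumr; apply: eq_bigr => p _ /=.
exact: (scalable_linear (Hf.1 p.2)).
Qed.

Lemma tensorP s t : reflect
  (forall W (f : U -> V -> W), bilinear_map f -> feval f s = feval f t)
  (\pi_tensor s == \pi_tensor t).
Proof. by rewrite piE; apply: asboolP. Qed.

Lemma feval_repr W (f : U -> V -> W) s : bilinear_map f ->
  feval f (repr (\pi_tensor s)) = feval f s.
Proof. by apply/tensorP; rewrite reprK. Qed.

Definition tzero : tensor := \pi_tensor [::].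
Definition tadd (x y : tensor) : tensor := \pi_tensor (repr x ++ repr y).
Definition tscale a (x : tensor) : tensor := \pi_tensor (fscale a (repr x)).
Definition topp (x : tensor) : tensor := tscale (-1) x.

Lemma tlift_inj (x y : tensor) :
  (forall W (f : U -> V -> W), bilinear_map f -> tlift f x = tlift f y) -> x = y.
Proof. by move=> H; rewrite -[x]reprK -[y]reprK; apply/eqP/tensorP. Qed.

Lemma tlift0' W (f : U -> V -> W) : bilinear_map f -> tlift f tzero = 0.
Proof. by move=> Hf; rewrite /tlift feval_repr // /feval big_nil. Qed.
Lemma tliftD' W (f : U -> V -> W) x y : bilinear_map f ->
  tlift f (tadd x y) = tlift f x + tlift f y.
Proof. by move=> Hf; rewrite /tlift feval_repr // fevalcat. Qed.
Lemma tliftZ' W (f : U -> V -> W) a x : bilinear_map f ->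
  tlift f (tscale a x) = a *: tlift f x.
Proof. by move=> Hf; rewrite /tlift feval_repr // fevalscale. Qed.

Let tE := (tliftD', tliftZ', tlift0').

Lemma taddA : associative tadd.
Proof. by move=> x y z; apply: tlift_inj => W f Hf; rewrite !tE // addrA. Qed.
Lemma taddC : commutative tadd.
Proof. by move=> x y; apply: tlift_inj => W f Hf; rewrite !tE // addrC. Qed.
Lemma tadd0 : left_id tzero tadd.
Proof. by move=> x; apply: tlift_inj => W f Hf; rewrite !tE // add0r. Qed.
Lemma taddN : left_inverse tzero topp tadd.
Proof.
by move=> x; apply: tlift_inj => W f Hf; rewrite !tE // scaleN1r addNr.
Qed.

HB.instance Definition _ := GRing.isZmodule.Build tensor taddA taddC tadd0 taddN.

Lemma tscaleA a b x : tscale a (tscale b x) = tscale (a * b) x.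
Proof. by apply: tlift_inj => W f Hf; rewrite !tE // scalerA. Qed.
Lemma tscale1 : left_id 1 tscale.
Proof. by move=> x; apply: tlift_inj => W f Hf; rewrite !tE // scale1r. Qed.
Lemma tscaleDr : right_distributive tscale +%R.
Proof.
by move=> a x y; apply: tlift_inj => W f Hf; rewrite !tE // scalerDr.
Qed.
Lemma tscaleDl x : {morph tscale^~ x : a b / a + b}.
Proof.
by move=> a b; apply: tlift_inj => W f Hf; rewrite !tE // scalerDl.
Qed.

HB.instance Definition _ := GRing.Zmodule_isLmodule.Build k tensor
  tscaleA tscale1 tscaleDr tscaleDl.

Lemma tlift_linear W (f : U -> V -> W) : bilinear_map f -> linear (tlift f).
Proof. by move=> Hf a x y; rewrite !tE. Qed.

Lemma tlift_pure W (f : U -> V -> W) u v :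
  bilinear_map f -> tlift f (pure u v) = f u v.
Proof. by move=> Hf; rewrite /tlift feval_repr // /feval big_seq1. Qed.

Lemma pure_bilinear : bilinear_map pure.
Proof.
split=> [v|u] a x y; apply: tlift_inj => W f Hf;
  rewrite tlift_linear // !tlift_pure //.
- exact: (Hf.1 v).
- exact: (Hf.2 u).
Qed.

Lemma tensor_sum (x : tensor) : x = \sum_(p <- repr x) pure p.1 p.2.
Proof.
rewrite -[LHS]reprK; elim: (repr x) => [|[u v] s IHs]; first by rewrite big_nil.
rewrite big_cons -IHs; apply: tlift_inj => W f Hf.
rewrite tliftD' // tlift_pure // /tlift !feval_repr //.
by rewrite /feval big_cons.
Qed.

Lemma tensor_ext W (f g : tensor -> W) : linear f -> linear g ->
  (forall u v, f (pure u v) = g (pure u v)) -> f =1 g.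
Proof.
move=> Hf Hg fg x.
pose f' := HB.pack_for {linear tensor -> W} f (GRing.isLinear.Build k tensor W _ f Hf).
pose g' := HB.pack_for {linear tensor -> W} g (GRing.isLinear.Build k tensor W _ g Hg).
rewrite [x]tensor_sum -[f]/(f' : _ -> _) -[g]/(g' : _ -> _) !linear_sum.
by apply: eq_bigr => p _; apply: fg.
Qed.

End Tensor.

Notation "x \ox y" := (pure x y) (at level 40, left associativity) : ring_scope.

Section PlainLinear.
Variables (k : fieldType) (U V W : lmodType k).

Lemma lin0 (f : U -> V) : linear f -> f 0 = 0.
Proof. by move=> Hf; have := zmod_morphism_linear Hf 0 0; rewrite !subrr. Qed.
Lemma linD (f : U -> V) : linear f -> {morph f : x y / x + y}.
Proof. by move=> Hf x y; have := Hf 1 x y; rewrite !scale1r. Qed.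
Lemma linB (f : U -> V) : linear f -> {morph f : x y / x - y}.
Proof. exact: zmod_morphism_linear. Qed.
Lemma linZ (f : U -> V) : linear f -> forall a, {morph f : x / a *: x}.
Proof. by move=> Hf a x; apply: scalable_linear. Qed.
Lemma lin_sum (f : U -> V) : linear f -> forall I (r : seq I) (P : pred I) F,
  f (\sum_(i <- r | P i) F i) = \sum_(i <- r | P i) f (F i).
Proof.
by move=> Hf I r P F; apply: (big_morph f (linD Hf) (lin0 Hf)).
Qed.
Lemma lin_comp (g : V -> W) (f : U -> V) :
  linear g -> linear f -> linear (fun x => g (f x)).
Proof. by move=> Hg Hf a x y; rewrite Hf Hg. Qed.
Lemma bilin_comp (U' V' : lmodType k) (h : U -> V -> W) (f : U' -> U) (g : V' -> V) :
  bilinear_map h -> linear f -> linear g -> bilinear_map (fun x y => h (f x) (g y)).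
Proof.
by move=> Hh Hf Hg; split=> z a x y; rewrite ?Hf ?Hg; [apply: Hh.1|apply: Hh.2].
Qed.
Lemma lin_bilin (X : lmodType k) (h : W -> X) (f : U -> V -> W) :
  linear h -> bilinear_map f -> bilinear_map (fun x y => h (f x y)).
Proof.
by move=> Hh Hf; split=> z a x y; rewrite ?(Hf.1 z) ?(Hf.2 z) /= Hh.
Qed.
Lemma bilin_swap (f : U -> V -> W) :
  bilinear_map f -> bilinear_map (fun y x => f x y).
Proof. by move=> Hf; split=> z a x y; [apply: (Hf.2 z)|apply: (Hf.1 z)]. Qed.
End PlainLinear.

Section TLiftFamily.
Variable (k : fieldType).

Lemma tlift_ext (U V : algType k) (W : lmodType k) (f g : U -> V -> W) :
  f =2 g -> tlift f =1 tlift g.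
Proof. by move=> fg x; apply: eq_bigr => p _; apply: fg. Qed.

Lemma tlift_family (U V : algType k) (W X : lmodType k)
    (f : X -> U -> V -> W) (x : tensor U V) :
  (forall u v, linear (fun z => f z u v)) -> linear (fun z => tlift (f z) x).
Proof.
move=> Hf a z z'; rewrite /tlift /feval scaler_sumr -big_split /=.
by apply: eq_bigr => p _; rewrite Hf.
Qed.

Lemma tlift_comp (U V : algType k) (W X : lmodType k) (h : W -> X) (f : U -> V -> W) x :
  linear h -> h (tlift f x) = tlift (fun u v => h (f u v)) x.
Proof. by move=> Hh; rewrite /tlift /feval lin_sum. Qed.
End TLiftFamily.

(* A nonzero vector is separated from 0 by some linear form. *)
Section LinearForm.
Variables (k : fieldType) (V : lmodType k) (v : V).
Hypothesis v0 : v != 0.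

Let good (E : set V) := (forall a x y, E x -> E y -> E (a *: x + y)) /\ ~ E v.

Let span0 : exists E : set V, E 0 /\ good E /\
  forall F : set V, good F -> (forall x, E x -> F x) -> forall x, F x -> E x.
Proof.
have [| E [gE] maxE] := @Zorn_bigcup V (fun E => good E).
  move=> F gF totF; split.
    move=> a x y [X FX Xx] [Y FY Yy].
    have [XY|YX] := totF _ _ FX FY.
      by exists Y => //; apply: (gF _ FY).1 => //; apply: XY.
    by exists X => //; apply: (gF _ FX).1 => //; apply: YX.
  by move=> [X FX Xv]; apply: (gF _ FX).2.
have mE F : good F -> (forall x, E x -> F x) -> forall x, F x -> E x.
  move=> gF EF x Fx; case: (pselect (F `<=` E)%classic) => [/(_ x)|nFE]; first exact.
  by case: (maxE F) => //; split.
exists E; split=> //.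
pose F := fun x => E x \/ x = 0.
have gF : good F.
  split; last by case=> [/gE.2//|/eqP]; apply/negP.
  move=> a x y [Ex|->] [Ey|->].
  - by left; apply: gE.1.
  - have E0 : E 0 by have := gE.1 (-1) x x Ex Ex; rewrite scaleN1r addNr.
    by left; apply: gE.1.
  - by left; rewrite scaler0 add0r.
  - by right; rewrite scaler0 add0r.
by apply: (mE F) => //; [move=> x Ex; left|right].
Qed.

Lemma linear_form : exists f : V -> k^o, linear f /\ f v = 1.
Proof.
have [E [E0 [gE maxE]]] := span0.
have EZ a x : E x -> E (a *: x) by move=> Ex; rewrite -[_ *: _]addr0; apply: gE.1.
have ED x y : E x -> E y -> E (x + y).
  by move=> Ex Ey; rewrite -[x]scale1r; apply: gE.1.
have EB x y : E x -> E y -> E (x - y).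
  by move=> Ex Ey; rewrite addrC -scaleN1r; apply: gE.1.
have dec x : exists c, E (x - c *: v).
  case: (pselect (exists c, E (x - c *: v))) => // nx.
  pose F := fun y => exists c, E (y - c *: x).
  have EF y : E y -> F y by move=> Ey; exists 0; rewrite scale0r subr0.
  have gF : good F.
    split.
      move=> a y z [c Ec] [d Ed]; exists (a * c + d).
      rewrite scalerDl -scalerA opprD addrACA -scalerBr; exact: gE.1.
    move=> [c Ec]; apply: nx.
    have [c0|c0] := eqVneq c 0.
      by case: gE.2; move: Ec; rewrite c0 scale0r subr0.
    exists c^-1; rewrite -opprB.
    have := EZ (- c^-1) _ Ec; rewrite scaleNr scalerBr scalerA mulVf // scale1r.
    by [].
  have Ex : E x by apply: (maxE F gF EF); exists 1; rewrite scale1r subrr.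
  by case: nx; exists 0; rewrite scale0r subr0.
have uniq_c x c d : E (x - c *: v) -> E (x - d *: v) -> c = d.
  move=> Ec Ed; apply/eqP; rewrite -subr_eq0; apply/negPn/negP => cd.
  apply: gE.2; have := EZ (c - d)^-1 _ (EB _ _ Ed Ec).
  have -> : x - d *: v - (x - c *: v) = (c - d) *: v.
    by rewrite opprB [LHS]addrC addrA subrK -scalerBl.
  by rewrite scalerA mulVf // scale1r.
pose f x : k^o := projT1 (cid (dec x)).
have fP x : E (x - f x *: v) by rewrite /f; case: cid.
exists f; split.
  move=> a x y; apply: (uniq_c _ _ _ (fP _)).
  rewrite scalerDl -[a *: f x]/(a * f x) -scalerA opprD addrACA -scalerBr.
  exact: gE.1.
by apply: (uniq_c v _ _ (fP v)); rewrite scale1r subrr.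
Qed.
End LinearForm.

Section TensorAlgebra.
Variables (k : fieldType) (A B : algType k).
Implicit Types x y z : tensor A B.

Let mulpp_bilin (a : A) (b : B) :
  bilinear_map (fun c d => (a * c) \ox (b * d)).
Proof.
apply: (bilin_comp (@pure_bilinear k A B)) => e c d.
  by rewrite mulrDr scalerAr.
by rewrite mulrDr scalerAr.
Qed.

Let mulp_bilin y : bilinear_map (fun a b => tlift (fun c d => (a * c) \ox (b * d)) y).
Proof.
split=> [b|a].
  apply: (@tlift_family _ _ _ _ _ (fun a c d => (a * c) \ox (b * d))) => c d e x x'.
  by rewrite mulrDl -scalerAl (pure_bilinear _ _).1.
apply: (@tlift_family _ _ _ _ _ (fun b c d => (a * c) \ox (b * d))) => c d e x x'.
by rewrite mulrDl -scalerAl (pure_bilinear _ _).2.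
Qed.

(* Determined by (a \ox b) * (c \ox d) = (a * c) \ox (b * d). *)
Definition tmul x y : tensor A B :=
  tlift (fun a b => tlift (fun c d => (a * c) \ox (b * d)) y) x.
Definition tone : tensor A B := 1 \ox 1.

Lemma tmul_pure (a c : A) (b d : B) :
  tmul (a \ox b) (c \ox d) = (a * c) \ox (b * d).
Proof. by rewrite /tmul !tlift_pure. Qed.

Lemma tmul_linl y : linear (tmul^~ y).
Proof. exact: tlift_linear. Qed.
Lemma tmul_linr x : linear (tmul x).
Proof. by apply: tlift_family => a b; apply: tlift_linear. Qed.

Lemma tmulA : associative tmul.
Proof.
move=> x y z; move: x; apply: tensor_ext => [||a b].
- exact: tmul_linl.
- apply: lin_comp; exact: tmul_linl.
move: y; apply: tensor_ext => [||c d].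
- apply: (lin_comp (tmul_linr _)); exact: tmul_linl.
- apply: (lin_comp (tmul_linl _)); exact: tmul_linr.
move: z; apply: tensor_ext => [||e f].
- apply: (lin_comp (tmul_linr _)); exact: tmul_linr.
- exact: tmul_linr.
by rewrite !tmul_pure !mulrA.
Qed.

Lemma tmul1 : left_id tone tmul.
Proof.
apply: tensor_ext => [||a b]; [exact: tmul_linr|by []|].
by rewrite tmul_pure !mul1r.
Qed.
Lemma tmulr1 : right_id tone tmul.
Proof.
apply: tensor_ext => [||a b]; [exact: tmul_linl|by []|].
by rewrite tmul_pure !mulr1.
Qed.
Lemma tmulDl : left_distributive tmul +%R.
Proof. by move=> x y z; apply: (linD (tmul_linl z)). Qed.
Lemma tmulDr : right_distributive tmul +%R.
Proof. by move=> x y z; apply: (linD (tmul_linr x)). Qed.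

Lemma tone_neq0 : tone != 0.
Proof.
have [f [Hf f1]] := linear_form (oner_neq0 A).
have [g [Hg g1]] := linear_form (oner_neq0 B).
have Hfg : bilinear_map (fun a b => f a * g b : k^o).
  split=> [b|a] e c d; rewrite ?Hf ?Hg /=.
    by rewrite mulrDl -scalerAl.
  by rewrite mulrDr scalerAr.
apply/eqP => t0; have := tlift_pure 1 1 Hfg; rewrite -/tone t0.
by rewrite (lin0 (tlift_linear Hfg)) f1 g1 mulr1; move/esym/eqP; rewrite oner_eq0.
Qed.

HB.instance Definition _ := GRing.Zmodule_isNzRing.Build (tensor A B)
  tmulA tmul1 tmulr1 tmulDl tmulDr tone_neq0.

Lemma tscaleAl e x y : e *: (x * y) = (e *: x) * y.
Proof. exact: esym (linZ (tmul_linl y) e x). Qed.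
HB.instance Definition _ := GRing.Lmodule_isLalgebra.Build k (tensor A B) tscaleAl.
Lemma tscaleAr e x y : e *: (x * y) = x * (e *: y).
Proof. exact: esym (linZ (tmul_linr x) e y). Qed.
HB.instance Definition _ := GRing.Lalgebra_isAlgebra.Build k (tensor A B) tscaleAr.

Lemma mul_pure (a c : A) (b d : B) : (a \ox b) * (c \ox d) = (a * c) \ox (b * d).
Proof. exact: tmul_pure. Qed.
Lemma pure11 : (1 : A) \ox (1 : B) = 1. Proof. by []. Qed.
End TensorAlgebra.

Section TensorMaps.
Variable k : fieldType.

Definition tmap (U V U' V' : algType k) (f : U -> U') (g : V -> V')
  : tensor U V -> tensor U' V' := tlift (fun u v => f u \ox g v).

(* The rebracketing U (x) (V (x) W) -> (U (x) V) (x) W. *)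
Definition tassoc (U V W : algType k) :
    tensor U (tensor V W) -> tensor (tensor U V) W :=
  tlift (fun u => tlift (fun v w => u \ox v \ox w)).
End TensorMaps.

(* Iterated tensor products are bracketed to the left: the images of 1 (x) Phi,
   id (x) Delta (x) id, etc. are brought back to that form by tassoc. *)
Record quasiHopf (k : fieldType) := QuasiHopf {
  qh_alg :> unitAlgType k;
  comult : {lrmorphism qh_alg -> tensor qh_alg qh_alg};
  counit : {lrmorphism qh_alg -> k^o};
  Phi : tensor (tensor qh_alg qh_alg) qh_alg;
  PhiV : tensor (tensor qh_alg qh_alg) qh_alg;
  antipode : {linear qh_alg -> qh_alg};
  qalpha : qh_alg;
  qbeta : qh_alg;
  mulPhiV : Phi * PhiV = 1;
  mulVPhi : PhiV * Phi = 1;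
  antipode1 : antipode 1 = 1;
  antipodeM : forall x y, antipode (x * y) = antipode y * antipode x;
  pentagon :
    tmap (@tassoc k qh_alg qh_alg qh_alg) id (tassoc (1 \ox Phi))
      * tmap (fun t => tassoc (tmap id comult t)) id Phi
      * (Phi \ox 1)
    = tassoc (tmap id comult Phi) * tmap (tmap comult id) id Phi;
  quasi_coassoc : forall x,
    Phi * tmap comult id (comult x) = tassoc (tmap id comult (comult x)) * Phi;
  counit_Phi : tmap (tlift (fun x y : qh_alg => (counit y : k) *: x)) id Phi = 1;
  comult_counitr : forall x, tlift (fun y z => (counit z : k) *: y) (comult x) = x;
  comult_counitl : forall x, tlift (fun y z => (counit y : k) *: z) (comult x) = x;
  antipode_alpha : forall x,
    tlift (fun y z => antipode y * qalpha * z) (comult x) = (counit x : k) *: qalpha;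
  antipode_beta : forall x,
    tlift (fun y z => y * qbeta * antipode z) (comult x) = (counit x : k) *: qbeta;
  zigzag_Phi :
    tlift (fun xy z =>
      tlift (fun x y => x * qbeta * antipode y * qalpha * z) xy) Phi = 1;
  zigzag_PhiV :
    tlift (fun xy z =>
      tlift (fun x y => antipode x * qalpha * y * qbeta * antipode z) xy) PhiV
    = 1;
  counit_alpha : counit qalpha = 1;
  counit_beta : counit qbeta = 1
}.

Arguments comult {k q}.
Arguments counit {k q}.
Arguments antipode {k q}.
Arguments Phi {k} q.
Arguments PhiV {k} q.
Arguments qalpha {k} q.
Arguments qbeta {k} q.

(* The image of P * Q in U * V, that is, the subspace P (x) Q. *)
Definition tensor_pred (k : fieldType) (U V : algType k)
    (P : {pred U}) (Q : {pred V}) : {pred tensor U V} :=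
  fun t => `[< exists2 s : seq (U * V),
    all (fun p => (p.1 \in P) && (p.2 \in Q)) s
    & t = \sum_(p <- s) p.1 \ox p.2 >].

(* The decomposition of A as a direct sum is internal: every element is a finite
   sum of homogeneous ones, and homogeneous elements of pairwise distinct degrees
   with sum 0 are all 0. *)
Record gradedQuasiHopf (k : fieldType) (N : groupType) := GradedQuasiHopf {
  gr_qh :> quasiHopf k;
  homog : N -> {pred gr_qh};
  homog_submod : forall n, submod_closed (homog n);
  homog_span : forall x, exists (s : seq N) (f : N -> gr_qh),
    (forall n, f n \in homog n) /\ x = \sum_(n <- s) f n;
  homog_free : forall (s : seq N) (f : N -> gr_qh), uniq s ->
    (forall n, f n \in homog n) -> \sum_(n <- s) f n = 0 ->
    forall n, n \in s -> f n = 0;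
  homogM : forall n m x y, x \in homog n -> y \in homog m ->
    x * y \in homog (n * m)%g;
  homog_comult : forall n x, x \in homog n ->
    comult x \in tensor_pred (homog n) (homog n);
  homog_antipode : forall n x, x \in homog n -> antipode x \in homog (n^-1)%g;
  homog_Phi : Phi gr_qh \in
    tensor_pred (tensor_pred (homog 1%g) (homog 1%g)) (homog 1%g);
  homog_alpha : qalpha gr_qh \in homog 1%g;
  homog_beta : qbeta gr_qh \in homog 1%g
}.
Arguments homog {k N} g n.

Definition crossed_product (k : fieldType) (N : groupType)
    (A : gradedQuasiHopf k N) : Prop :=
  forall n : N, exists2 x : A, x \in homog A n & x \is a GRing.unit.

Section TensorMapTheory.
Variable k : fieldType.
Implicit Types U V X : algType k.
Implicit Types W : lmodType k.

Lemma tmap_bilin U V U' V' (f : U -> U') (g : V -> V') :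
  linear f -> linear g -> bilinear_map (fun u v => f u \ox g v).
Proof. by move=> Hf Hg; apply: (bilin_comp (@pure_bilinear k U' V')). Qed.

Lemma tmap_linear U V U' V' (f : U -> U') (g : V -> V') :
  linear f -> linear g -> linear (tmap f g).
Proof. by move=> Hf Hg; apply: tlift_linear; apply: tmap_bilin. Qed.

Lemma tmap_pure U V U' V' (f : U -> U') (g : V -> V') u v :
  linear f -> linear g -> tmap f g (u \ox v) = f u \ox g v.
Proof. by move=> Hf Hg; apply: tlift_pure; apply: tmap_bilin. Qed.

Lemma tassoc_bilin U V (W : algType k) :
  bilinear_map (fun (u : U) => tlift (fun (v : V) (w : W) => u \ox v \ox w)).
Proof.
have Hu (u : U) : bilinear_map (fun (v : V) (w : W) => u \ox v \ox w).
  by split=> [w|v] a x y; rewrite ?(pure_bilinear _ _).2 ?(pure_bilinear _ _).1.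
split=> [t|u]; last exact: tlift_linear.
apply: (@tlift_family _ _ _ _ _ (fun (u : U) (v : V) (w : W) => u \ox v \ox w)).
by move=> v w a x y; rewrite !(pure_bilinear _ _).1.
Qed.

Lemma tassoc_linear U V (W : algType k) : linear (@tassoc k U V W).
Proof. exact: (tlift_linear (@tassoc_bilin U V W)). Qed.

Lemma tassoc_pure U V (W : algType k) (u : U) (v : V) (w : W) :
  tassoc (u \ox (v \ox w)) = u \ox v \ox w.
Proof.
rewrite /tassoc tlift_pure; last exact: tassoc_bilin.
by rewrite tlift_pure //; split=> [{}w|{}v] a x y;
  rewrite ?(pure_bilinear _ _).2 ?(pure_bilinear _ _).1.
Qed.

Lemma lin_id U : linear (fun x : U => x). Proof. by []. Qed.

Lemma tmap_sq U V U1 V1 U2 V2 U' V' (f : U -> U1) (g : V -> V1)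
    (f' : U1 -> U') (g' : V1 -> V') (h : U -> U2) (l : V -> V2)
    (h' : U2 -> U') (l' : V2 -> V') :
  linear f -> linear g -> linear f' -> linear g' ->
  linear h -> linear l -> linear h' -> linear l' ->
  (forall x, f' (f x) = h' (h x)) -> (forall y, g' (g y) = l' (l y)) ->
  forall t, tmap f' g' (tmap f g t) = tmap h' l' (tmap h l t).
Proof.
move=> Hf Hg Hf' Hg' Hh Hl Hh' Hl' e1 e2; apply: tensor_ext.
- by apply: lin_comp; apply: tmap_linear.
- by apply: lin_comp; apply: tmap_linear.
by move=> u v; rewrite !tmap_pure // e1 e2.
Qed.

Lemma tmap_id U V (f : U -> U) (g : V -> V) :
  (forall x, f x = x) -> (forall y, g y = y) -> forall t, tmap f g t = t.
Proof.
move=> fE gE t; rewrite [RHS]tensor_sum /tmap /tlift /feval.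
by apply: eq_bigr => p _; rewrite fE gE.
Qed.

Lemma tmap_cancel U V U' V' (f : U -> U') (g : V -> V') f' g' :
  linear f -> linear g -> linear f' -> linear g' ->
  cancel f f' -> cancel g g' -> cancel (tmap f g) (tmap f' g').
Proof.
move=> Hf Hg Hf' Hg' fK gK t.
rewrite (@tmap_sq _ _ _ _ _ _ _ _ f g f' g' id id id id) //.
by rewrite !tmap_id.
Qed.

Lemma tmap_cancel_in U V U' V' (f : U -> U') (g : V -> V') f' g'
    (P : {pred U}) (Q : {pred V}) :
  linear f -> linear g -> linear f' -> linear g' ->
  {in P, cancel f f'} -> {in Q, cancel g g'} ->
  {in tensor_pred P Q, cancel (tmap f g) (tmap f' g')}.
Proof.
move=> Hf Hg Hf' Hg' fK gK t /asboolP[s /allP sPQ ->].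
rewrite (lin_sum (tmap_linear Hf Hg)) (lin_sum (tmap_linear Hf' Hg')).
rewrite big_seq [RHS]big_seq; apply: eq_bigr => p /sPQ /andP[p1 p2].
by rewrite !tmap_pure // fK // gK.
Qed.

Lemma tassoc_nat U V (W : algType k) U' V' (W' : algType k)
    (f : U -> U') (g : V -> V') (h : W -> W') t :
  linear f -> linear g -> linear h ->
  tassoc (tmap f (tmap g h) t) = tmap (tmap f g) h (tassoc t).
Proof.
move=> Hf Hg Hh; move: t; apply: tensor_ext.
- by apply: lin_comp; [apply: tassoc_linear|do 2?apply: tmap_linear].
- by apply: lin_comp; [do 2?apply: tmap_linear|apply: tassoc_linear].
move=> u t; rewrite tmap_pure //; last exact: tmap_linear.
move: t; apply: tensor_ext.
- move=> a x y; rewrite tmap_linear // (pure_bilinear _ _).2 /=.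
  by rewrite tassoc_linear.
- move=> a x y; rewrite (pure_bilinear _ _).2 /= tassoc_linear tmap_linear //.
  exact: tmap_linear.
move=> v w; rewrite tmap_pure // !tassoc_pure !tmap_pure //.
exact: tmap_linear.
Qed.

Lemma tlift_tmap U V U' V' W (f : U -> U') (g : V -> V') (h : U' -> V' -> W) t :
  linear f -> linear g -> bilinear_map h ->
  tlift h (tmap f g t) = tlift (fun u v => h (f u) (g v)) t.
Proof.
move=> Hf Hg Hh; move: t; apply: tensor_ext.
- by apply: lin_comp; [apply: tlift_linear|apply: tmap_linear].
- by apply: tlift_linear; apply: bilin_comp.
move=> u v; rewrite tmap_pure // !tlift_pure //.
exact: bilin_comp.
Qed.

Lemma tmap_mulr (A A' B B' : algType k) (i : A -> A') (f : A' -> A)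
    (j : B -> B') (g : B' -> B) :
  linear i -> linear f -> linear j -> linear g ->
  (forall a x, f (i a * x) = a * f x) -> (forall b y, g (j b * y) = b * g y) ->
  forall s t, tmap f g (tmap i j s * t) = s * tmap f g t.
Proof.
move=> Hi Hf Hj Hg fE gE s t; move: s; apply: tensor_ext.
- apply: (lin_comp (tmap_linear Hf Hg)); apply: (lin_comp (tmul_linl t)).
  exact: tmap_linear.
- exact: tmul_linl.
move=> a b; rewrite tmap_pure //; move: t; apply: tensor_ext.
- apply: (lin_comp (tmap_linear Hf Hg)); exact: tmul_linr.
- apply: (lin_comp (tmul_linr _)); exact: tmap_linear.
by move=> c d; rewrite mul_pure !tmap_pure // mul_pure fE gE.
Qed.

Lemma tmapM (A A' B B' : algType k) (f : A -> A') (g : B -> B') :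
  linear f -> linear g -> {morph f : x y / x * y} -> {morph g : x y / x * y} ->
  {morph tmap f g : s t / s * t}.
Proof.
move=> Hf Hg fM gM s t; have H := tmap_linear Hf Hg; move: s; apply: tensor_ext.
- apply: (lin_comp H); exact: tmul_linl.
- apply: (lin_comp (tmul_linl _)); exact: H.
move=> a b; move: t; apply: tensor_ext.
- apply: (lin_comp H); exact: tmul_linr.
- apply: (lin_comp (tmul_linr _)); exact: H.
by move=> c d; rewrite mul_pure !tmap_pure // mul_pure fM gM.
Qed.
End TensorMapTheory.

Section NeutralComponent.
Variables (k : fieldType) (N : groupType) (A : gradedQuasiHopf k N).

Definition homog1 : {pred A} := homog A 1%g.

Lemma homog0 (n : N) : (0 : A) \in homog A n.
Proof. by case: (homog_submod A n). Qed.
Lemma homogP (n : N) a (x y : A) :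
  x \in homog A n -> y \in homog A n -> a *: x + y \in homog A n.
Proof. by case: (homog_submod A n) => _; apply. Qed.
Lemma homogD (n : N) (x y : A) :
  x \in homog A n -> y \in homog A n -> x + y \in homog A n.
Proof. by rewrite -{2}[x]scale1r; apply: homogP. Qed.
Lemma homogZ (n : N) a (x : A) : x \in homog A n -> a *: x \in homog A n.
Proof. by move=> Hx; rewrite -[_ *: _]addr0; apply: homogP => //; apply: homog0. Qed.
Lemma homogB (n : N) (x y : A) :
  x \in homog A n -> y \in homog A n -> x - y \in homog A n.
Proof. by move=> Hx Hy; rewrite addrC -scaleN1r; apply: homogP. Qed.
Lemma homog_sumr (n : N) I (r : seq I) (P : pred I) (F : I -> A) :
  (forall i, P i -> F i \in homog A n) -> \sum_(i <- r | P i) F i \in homog A n.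
Proof.
by move=> HF; elim/big_rec: _ => [|i x Pi Hx];
  [apply: homog0|apply: homogD => //; apply: HF].
Qed.

(* Sums of homogeneous elements of degrees different from n. *)
Let off (n : N) (z : A) := exists2 l : seq (N * A),
  all (fun p => (p.1 != n) && (p.2 \in homog A p.1)) l & z = \sum_(p <- l) p.2.

Let offP n a x y : off n x -> off n y -> off n (a *: x + y).
Proof.
move=> [l /allP Hl ->] [m Hm ->]; exists ([seq (p.1, a *: p.2) | p <- l] ++ m).
  rewrite all_cat Hm andbT; apply/allP => _ /mapP[p /Hl /andP[p1 p2] ->] /=.
  by rewrite p1 homogZ.
by rewrite big_cat big_map scaler_sumr.
Qed.

Let off0 n : off n 0. Proof. by exists [::]; rewrite ?big_nil. Qed.

Let offN n x : off n x -> off n (- x).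
Proof. by move=> Hx; rewrite -scaleN1r -[_ *: _]addr0; apply: offP. Qed.

Let off_disj n y : y \in homog A n -> off n y -> y = 0.
Proof.
move=> Hy [l /allP Hl yE].
pose f m := if m == n then - y else \sum_(p <- l | p.1 == m) p.2.
have Hf m : f m \in homog A m.
  rewrite /f; case: eqP => [->|_]; first by rewrite -sub0r homogB ?homog0.
  rewrite big_seq_cond; apply: homog_sumr => p /andP[/Hl /andP[_ Hp] /eqP <-] //.
pose s := undup [seq p.1 | p <- l].
have ns : n \notin s.
  by rewrite mem_undup; apply/mapP => -[p /Hl /andP[/eqP pn _] /esym].
have us : uniq (n :: s) by rewrite /= ns undup_uniq.
have sumf : \sum_(m <- n :: s) f m = 0.
  rewrite big_cons /f eqxx.
  have -> : \sum_(m <- s) (if m == n then - y else \sum_(p <- l | p.1 == m) p.2)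
            = \sum_(m <- s) \sum_(p <- l) (if p.1 == m then p.2 else 0).
    rewrite big_seq [RHS]big_seq; apply: eq_bigr => m ms.
    by case: eqP => [mn|_]; [rewrite mn (negPf ns) in ms|rewrite big_mkcond].
  rewrite exchange_big /= [X in - X]yE addrC; apply/eqP; rewrite subr_eq0; apply/eqP.
  rewrite big_seq [RHS]big_seq; apply: eq_bigr => p pl.
  have ps : p.1 \in s by rewrite mem_undup map_f.
  rewrite (bigD1_seq p.1) ?undup_uniq //= eqxx big1 ?addr0 // => m.
  by rewrite eq_sym => /negPf ->.
have := @homog_free _ _ A _ _ us Hf sumf n (mem_head _ _); rewrite /f eqxx.
by move/eqP; rewrite oppr_eq0 => /eqP.
Qed.

Let split_at n x : exists2 y : A, y \in homog A n & off n (x - y).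
Proof.
have [s [f [Hf ->]]] := @homog_span _ _ A x.
elim: s => [|m s [y Hy Oy]].
  by exists 0; rewrite ?homog0 // big_nil subr0; apply: off0.
rewrite big_cons; have [mn|mn] := eqVneq m n.
  exists (f m + y); first by rewrite homogD // -mn.
  by rewrite opprD addrACA subrr add0r.
exists y => //; rewrite -addrA -[f m]scale1r; apply: offP => //.
by exists [:: (m, f m)]; rewrite ?big_seq1 //= mn Hf.
Qed.

Let split_uniq n x y y' : y \in homog A n -> y' \in homog A n ->
  off n (x - y) -> off n (x - y') -> y = y'.
Proof.
move=> Hy Hy' Oy Oy'; apply/eqP; rewrite -subr_eq0; apply/eqP.
apply: (@off_disj n); first exact: homogB.
have -> : y - y' = (-1) *: (x - y) + (x - y').
  by rewrite scaleN1r opprB addrA subrK.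
exact: offP.
Qed.

Definition proj1 (x : A) : A := s2val (cid2 (split_at 1%g x)).

Let proj1P x : proj1 x \in homog A 1%g /\ off 1%g (x - proj1 x).
Proof. by rewrite /proj1; case: cid2. Qed.

Let proj1_eq x y : y \in homog A 1%g -> off 1%g (x - y) -> proj1 x = y.
Proof. by move=> Hy Oy; have [? ?] := proj1P x; apply: split_uniq Oy. Qed.

Lemma proj1_in x : proj1 x \in homog A 1%g. Proof. by case: (proj1P x). Qed.

Lemma proj1_id x : x \in homog A 1%g -> proj1 x = x.
Proof. by move=> Hx; apply: proj1_eq => //; rewrite subrr; apply: off0. Qed.

Lemma proj1_linear : linear proj1.
Proof.
move=> a x y; apply: proj1_eq.
  by apply: homogP; apply: proj1_in.
rewrite opprD addrACA -scalerBr.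
by apply: offP; apply: (proj1P _).2.
Qed.

Let offMl n m x w : x \in homog A n -> off m w -> off (n * m)%g (x * w).
Proof.
move=> Hx [l /allP Hl ->]; exists [seq ((n * p.1)%g, x * p.2) | p <- l].
  apply/allP => _ /mapP[p /Hl /andP[p1 p2] ->] /=.
  by rewrite homogM // andbT; apply: contra p1 => /eqP /mulgI ->.
by rewrite big_map mulr_sumr.
Qed.

Lemma proj1Ml a x : a \in homog A 1%g -> proj1 (a * x) = a * proj1 x.
Proof.
have [Hp Op] := proj1P x; move=> Ha; apply: proj1_eq.
  by rewrite -[1%g]mulg1; apply: homogM.
by rewrite -mulrBr -[1%g]mulg1; apply: offMl.
Qed.

Lemma homog_1 : (1 : A) \in homog A 1%g.
Proof.
have [H1 O1] := proj1P 1.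
suff E x : x * proj1 1 = x by rewrite -(mul1r (proj1 1)) E in H1.
have [s [f [Hf ->]]] := @homog_span _ _ A x.
rewrite mulr_suml; apply: eq_bigr => n _; apply/esym.
apply: (@split_uniq n (f n)) => //.
- by rewrite -[X in homog _ X]mulg1; apply: homogM.
- by rewrite subrr; apply: off0.
rewrite -{1}[f n]mulr1 -mulrBr -[X in off X]mulg1; exact: offMl.
Qed.

Lemma homog1_divalg : divalg_closed homog1.
Proof.
split; [exact: homog_1|by move=> a x y; apply: homogP|].
have HM x y : x \in homog1 -> y \in homog1 -> x * y \in homog1.
  by rewrite /homog1 -{3}[1%g]mulg1; apply: homogM.
move=> x y Hx Hy; apply: HM => //.
have [Uy|NUy] := boolP (y \is a GRing.unit); last by rewrite invr_out.
suff -> : y^-1 = proj1 y^-1 by apply: proj1_in.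
by apply: (mulrI Uy); rewrite -proj1Ml // divrr // proj1_id //; apply: homog_1.
Qed.

HB.instance Definition _ := GRing.isDivalgClosed.Build k A homog1 homog1_divalg.

Definition neutral_alg := {x : A | x \in homog1}.
HB.instance Definition _ := [isSub for (@sval _ _ : neutral_alg -> A)].
HB.instance Definition _ := [Choice of neutral_alg by <:].
HB.instance Definition _ := [SubChoice_isSubAlgebra of neutral_alg by <:].
HB.instance Definition _ := [SubNzRing_isSubUnitRing of neutral_alg by <:].

End NeutralComponent.

(* The quasi-Hopf structure restricted to the neutral component, presented as an
   algebra B with an inclusion i onto homog 1 and a B-linear retraction p. The
   retraction makes the inclusions of the tensor powers of B injective. *)
Section Restriction.
Variables (k : fieldType) (N : groupType) (A : gradedQuasiHopf k N).
Variables (B : unitAlgType k) (i : B -> A) (p : A -> B).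
Hypotheses (il : linear i) (i_mon : monoid_morphism i) (pl : linear p).
Hypothesis (iin : forall x, i x \in homog A 1%g).
Hypothesis (ip : {in homog A 1%g, forall x, i (p x) = x}).
Hypothesis (pi : cancel i p).
Hypothesis (pM : forall a x, p (i a * x) = a * p x).

Let iM : {morph i : x y / x * y}. Proof. exact: i_mon.2. Qed.
Let i1 : i 1 = 1. Proof. exact: i_mon.1. Qed.

Let I2 := tmap i i. Let I3 := tmap I2 i. Let I4 := tmap I3 i.
Let P2 := tmap p p. Let P3 := tmap P2 p. Let P4 := tmap P3 p.
Let I2l : linear I2. Proof. exact: tmap_linear. Qed.
Let I3l : linear I3. Proof. exact: tmap_linear. Qed.
Let I4l : linear I4. Proof. exact: tmap_linear. Qed.
Let P2l : linear P2. Proof. exact: tmap_linear. Qed.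
Let P3l : linear P3. Proof. exact: tmap_linear. Qed.
Let P4l : linear P4. Proof. exact: tmap_linear. Qed.
Let I2K : cancel I2 P2. Proof. exact: tmap_cancel. Qed.
Let I3K : cancel I3 P3. Proof. exact: tmap_cancel. Qed.
Let I4K : cancel I4 P4. Proof. exact: tmap_cancel. Qed.
Let I2M : {morph I2 : x y / x * y}. Proof. exact: (tmapM il il iM iM). Qed.
Let I3M : {morph I3 : x y / x * y}. Proof. exact: (tmapM I2l il I2M iM). Qed.
Let I4M : {morph I4 : x y / x * y}. Proof. exact: (tmapM I3l il I3M iM). Qed.
Let I21 : I2 1 = 1. Proof. by rewrite -[1 in LHS]pure11 /I2 (tmap_pure _ _ il il) i1. Qed.
Let I31 : I3 1 = 1. Proof. by rewrite -[1 in LHS]pure11 /I3 (tmap_pure _ _ I2l il) I21 i1. Qed.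
Let P3M s t : P3 (I3 s * t) = s * P3 t.
Proof. exact: (tmap_mulr I2l P2l il pl (tmap_mulr il pl il pl pM pM) pM). Qed.

Let D : A -> tensor A A := comult.
Let Dl : linear D. Proof. exact: linearP. Qed.
Let S : A -> A := antipode.
Let Sl : linear S. Proof. exact: linearP. Qed.

Let S2 : {in tensor_pred (homog A 1%g) (homog A 1%g), cancel P2 I2}.
Proof. exact: (tmap_cancel_in pl pl il il ip ip). Qed.
Let S3 : {in tensor_pred (tensor_pred (homog A 1%g) (homog A 1%g))
               (homog A 1%g), cancel P3 I3}.
Proof. exact: (tmap_cancel_in P2l pl I2l il S2 ip). Qed.

Definition restr_comult (x : B) : tensor B B := tmap p p (comult (i x)).
Definition restr_counit (x : B) : k^o := counit (i x).
Definition restr_antipode (x : B) : B := p (antipode (i x)).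
Definition restr_Phi : tensor (tensor B B) B := tmap (tmap p p) p (Phi A).
Definition restr_PhiV : tensor (tensor B B) B := tmap (tmap p p) p (PhiV A).
Definition restr_alpha : B := p (qalpha A).
Definition restr_beta : B := p (qbeta A).

Let De := restr_comult.
Let Se := restr_antipode.
Let Del : linear De. Proof. by apply: (lin_comp P2l); apply: lin_comp. Qed.
Let Sel : linear Se. Proof. by apply: (lin_comp pl); apply: lin_comp. Qed.

Lemma i_restr_comult x : tmap i i (De x) = comult (i x).
Proof. by apply: S2; apply: homog_comult; apply: (iin x). Qed.
Lemma i_restr_antipode x : i (Se x) = antipode (i x).
Proof.
by apply: ip; rewrite -[X in homog _ X]invg1; apply: homog_antipode; apply: (iin x).
Qed.
Lemma i_restr_Phi : tmap (tmap i i) i restr_Phi = Phi A.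
Proof. by apply: S3; apply: homog_Phi. Qed.
Lemma i_restr_alpha : i restr_alpha = qalpha A.
Proof. by apply: ip; apply: homog_alpha. Qed.
Lemma i_restr_beta : i restr_beta = qbeta A.
Proof. by apply: ip; apply: homog_beta. Qed.

Let mulPhiVe : restr_Phi * restr_PhiV = 1.
Proof. by rewrite -P3M [I3 _]i_restr_Phi mulPhiV -I31 I3K. Qed.

Lemma i_restr_PhiV : tmap (tmap i i) i restr_PhiV = PhiV A.
Proof.
rewrite -[LHS]mul1r -mulVPhi -mulrA -[X in X * tmap _ _ _]i_restr_Phi.
by rewrite -[tmap _ _ _ * tmap _ _ _]I3M mulPhiVe I31 mulr1.
Qed.

Let mulVPhie : restr_PhiV * restr_Phi = 1.
Proof.
apply: (can_inj I3K).
by rewrite I3M [I3 _]i_restr_PhiV [I3 _]i_restr_Phi mulVPhi I31.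
Qed.

Let De_mon : monoid_morphism De.
Proof.
split.
  by apply: (can_inj I2K); rewrite [LHS]i_restr_comult I21 i1 rmorph1.
move=> x y; apply: (can_inj I2K).
by rewrite I2M ![I2 (De _)]i_restr_comult iM rmorphM.
Qed.
Let comulte : {lrmorphism B -> tensor B B} :=
  HB.pack_for {lrmorphism B -> tensor B B} De
    (GRing.isLinear.Build k B (tensor B B) _ De Del)
    (GRing.isMonoidMorphism.Build B (tensor B B) De De_mon).

Let ce_lin : linear restr_counit. Proof. exact: (lin_comp (linearP _) il). Qed.
Let ce_mon : monoid_morphism restr_counit.
Proof. by split=> [|x y]; rewrite /restr_counit ?i1 ?iM ?rmorph1 ?rmorphM. Qed.
Let counite : {lrmorphism B -> k^o} :=
  HB.pack_for {lrmorphism B -> k^o} restr_counit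
    (GRing.isLinear.Build k B k^o _ restr_counit ce_lin)
    (GRing.isMonoidMorphism.Build B k^o restr_counit ce_mon).

Let antipodee : {linear B -> B} :=
  HB.pack_for {linear B -> B} Se (GRing.isLinear.Build k B B _ Se Sel).

Let antipode1e : Se 1 = 1.
Proof. by apply: (can_inj pi); rewrite i_restr_antipode i1 antipode1. Qed.
Let antipodeMe x y : Se (x * y) = Se y * Se x.
Proof. by apply: (can_inj pi); rewrite i_restr_antipode !iM !i_restr_antipode antipodeM. Qed.

(* Compatibility of De with the inclusions in each tensor position. *)
Let DI x : I2 (De x) = D (i x). Proof. exact: i_restr_comult. Qed.

Let ta := tassoc_linear.

Let I_tassoc (x : tensor B (tensor B B)) : I3 (tassoc x) = tassoc (tmap i I2 x).
Proof. by rewrite tassoc_nat. Qed.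

Let I_tassoc4 (x : tensor (tensor B B) (tensor B B)) :
  I4 (tassoc x) = tassoc (tmap I2 I2 x).
Proof. by rewrite tassoc_nat. Qed.

Let I_idD (x : tensor B B) : tmap i I2 (tmap id De x) = tmap id D (I2 x).
Proof. exact: tmap_sq. Qed.
Let I_Did (x : tensor B B) : I3 (tmap De id x) = tmap D id (I2 x).
Proof. exact: tmap_sq. Qed.

Let lin_idD : linear (fun t : tensor A A => tassoc (tmap id D t)).
Proof. by apply: (lin_comp (@ta _ _ _ _)); apply: tmap_linear. Qed.
Let lin_idDe : linear (fun t : tensor B B => tassoc (tmap id De t)).
Proof. by apply: (lin_comp (@ta _ _ _ _)); apply: tmap_linear. Qed.

Let pentagone :
    tmap (@tassoc k B B B) id (tassoc (1 \ox restr_Phi))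
      * tmap (fun t : tensor B B => tassoc (tmap id De t)) id restr_Phi
      * (restr_Phi \ox 1)
    = tassoc (tmap id De restr_Phi) * tmap (tmap De id) id restr_Phi.
Proof.
have E := @pentagon k A.
apply: (can_inj I4K); rewrite !I4M.
have -> : I4 (tmap (@tassoc k B B B) id (tassoc (1 \ox restr_Phi)))
          = tmap (@tassoc k A A A) id (tassoc (1 \ox Phi A)).
  rewrite [LHS](@tmap_sq _ _ _ _ _ _ _ _ _ (@tassoc k B B B) id I3 i
    (tmap i I2) i (@tassoc k A A A) id) //; try exact: ta; try exact: tmap_linear.
  by rewrite -tassoc_nat // tmap_pure // [tmap I2 i _]i_restr_Phi i1.
have -> : I4 (tmap (fun t : tensor B B => tassoc (tmap id De t)) id restr_Phi)
          = tmap (fun t : tensor A A => tassoc (tmap id D t)) id (Phi A).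
  rewrite [LHS](@tmap_sq _ _ _ _ _ _ _ _ _ (fun t : tensor B B => tassoc (tmap id De t)) id I3 i
    I2 i (fun t : tensor A A => tassoc (tmap id D t)) id) //.
    by rewrite [tmap I2 i _]i_restr_Phi.
  by move=> x; rewrite I_tassoc I_idD.
have -> : I4 (restr_Phi \ox 1) = Phi A \ox 1.
  by rewrite [LHS]tmap_pure // [I3 _]i_restr_Phi i1.
rewrite E; congr (_ * _).
  rewrite I_tassoc4 (@tmap_sq _ _ _ _ _ _ _ _ _ id De I2 I2 I2 i id D) //.
  by rewrite [tmap I2 i _]i_restr_Phi.
rewrite [RHS](@tmap_sq _ _ _ _ _ _ _ _ _ (tmap De id) id I3 i
  I2 i (tmap D id) id) //; try exact: tmap_linear.
by rewrite [tmap I2 i _]i_restr_Phi.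
Qed.

Let quasi_coassoce x :
  restr_Phi * tmap De id (De x) = tassoc (tmap id De (De x)) * restr_Phi.
Proof.
apply: (can_inj I3K); rewrite !I3M I_Did I_tassoc I_idD DI [I3 _]i_restr_Phi.
exact: quasi_coassoc.
Qed.

Let cl_bilin (C : lmodType k) (c : {linear C -> k^o}) :
  bilinear_map (fun x y : C => c y *: x).
Proof.
split=> [y|x] a u v; first by rewrite /= scalerDr !scalerA mulrC.
by rewrite /= linearP scalerDl scalerA.
Qed.
Let cr_bilin (C : lmodType k) (c : {linear C -> k^o}) :
  bilinear_map (fun x y : C => c x *: y).
Proof. exact: (bilin_swap (cl_bilin c)). Qed.

Let ci x : restr_counit x = counit (i x). Proof. by []. Qed.

Let counit_Phie :
  tmap (tlift (fun x y : B => (counite y : k) *: x)) id restr_Phi = 1.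
Proof.
apply: (can_inj I2K).
rewrite [LHS](@tmap_sq _ _ _ _ _ _ _ _ _ _ id i i I2 i
  (tlift (fun x y : A => (counit y : k) *: x)) id) //.
- by rewrite [tmap I2 i _]i_restr_Phi counit_Phi I21.
- exact: (tlift_linear (cl_bilin counite)).
- exact: (tlift_linear (cl_bilin counit)).
move=> x; rewrite tlift_comp // (tlift_tmap _ il il (cl_bilin counit)).
by apply: tlift_ext => u v; rewrite (linZ il).
Qed.

Let comult_counitre x : tlift (fun y z => (counite z : k) *: y) (De x) = x.
Proof.
apply: (can_inj pi); rewrite -[RHS]comult_counitr -[comult _]DI.
rewrite tlift_comp // (tlift_tmap _ il il (cl_bilin counit)).
by apply: tlift_ext => u v; rewrite (linZ il).
Qed.
Let comult_counitle x : tlift (fun y z => (counite y : k) *: z) (De x) = x.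
Proof.
apply: (can_inj pi); rewrite -[RHS]comult_counitl -[comult _]DI.
rewrite tlift_comp // (tlift_tmap _ il il (cr_bilin counit)).
by apply: tlift_ext => u v; rewrite (linZ il).
Qed.

Let mulA_bilin (C : algType k) (f g : C -> C) (b : C) : linear f -> linear g ->
  bilinear_map (fun x y => f x * b * g y).
Proof.
move=> Hf Hg; split=> [y|x] a u v; first by rewrite Hf !mulrDl -!scalerAl.
by rewrite Hg mulrDr -scalerAr.
Qed.

Let antipode_alphae x :
  tlift (fun y z => Se y * restr_alpha * z) (De x) = (counite x : k) *: restr_alpha.
Proof.
apply: (can_inj pi); rewrite (linZ il) i_restr_alpha -[counite x]/(counit (i x)).
rewrite -antipode_alpha -[comult _]DI.
rewrite tlift_comp // (tlift_tmap _ il il (mulA_bilin (qalpha A) Sl (@lin_id k A))).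
by apply: tlift_ext => u v; rewrite !iM i_restr_antipode i_restr_alpha.
Qed.
Let antipode_betae x :
  tlift (fun y z => y * restr_beta * Se z) (De x) = (counite x : k) *: restr_beta.
Proof.
apply: (can_inj pi); rewrite (linZ il) i_restr_beta -[counite x]/(counit (i x)).
rewrite -antipode_beta -[comult _]DI.
rewrite tlift_comp // (tlift_tmap _ il il (mulA_bilin (qbeta A) (@lin_id k A) Sl)).
by apply: tlift_ext => u v; rewrite !iM i_restr_antipode i_restr_beta.
Qed.

Let I3_tlift (h : B -> B -> B -> B) (h' : A -> A -> A -> A) t :
  (forall z, bilinear_map (fun x y => h' x y z)) ->
  (forall x y, linear (h' x y)) ->
  (forall x y z, i (h x y z) = h' (i x) (i y) (i z)) ->
  i (tlift (fun xy z => tlift (fun x y => h x y z) xy) t)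
  = tlift (fun xy z => tlift (fun x y => h' x y z) xy) (I3 t).
Proof.
move=> Hb Hl E; rewrite tlift_comp //.
rewrite [RHS]tlift_tmap //; last first.
  split=> [z|xy]; first exact: tlift_linear.
  by apply: (@tlift_family _ _ _ _ _ (fun z x y => h' x y z)).
apply: tlift_ext => xy z; rewrite tlift_comp // tlift_tmap //.
by apply: tlift_ext => x y; apply: E.
Qed.

Let zigzag_Phie :
  tlift (fun xy z =>
    tlift (fun x y => x * restr_beta * Se y * restr_alpha * z) xy) restr_Phi = 1.
Proof.
apply: (can_inj pi); rewrite i1 -(@zigzag_Phi k A) -i_restr_Phi.
apply: (@I3_tlift (fun x y z => x * restr_beta * Se y * restr_alpha * z)
  (fun x y z => x * qbeta A * S y * qalpha A * z)).
- move=> z; split=> [y|x] a u v.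
    by rewrite !mulrDl -!scalerAl.
  by rewrite Sl mulrDr !mulrDl -scalerAr -!scalerAl.
- by move=> x y a u v; rewrite mulrDr -scalerAr.
- by move=> x y z; rewrite !iM i_restr_alpha i_restr_beta i_restr_antipode.
Qed.

Let zigzag_PhiVe :
  tlift (fun xy z =>
    tlift (fun x y => Se x * restr_alpha * y * restr_beta * Se z) xy) restr_PhiV = 1.
Proof.
apply: (can_inj pi); rewrite i1 -(@zigzag_PhiV k A) -i_restr_PhiV.
apply: (@I3_tlift (fun x y z => Se x * restr_alpha * y * restr_beta * Se z)
  (fun x y z => S x * qalpha A * y * qbeta A * S z)).
- move=> z; split=> [y|x] a u v.
    by rewrite Sl !mulrDl -!scalerAl.
  by rewrite mulrDr !mulrDl -scalerAr -!scalerAl.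
- by move=> x y a u v; rewrite Sl mulrDr -scalerAr.
- by move=> x y z; rewrite !iM i_restr_alpha i_restr_beta !i_restr_antipode.
Qed.

Let counit_alphae : counite restr_alpha = 1.
Proof. by rewrite [LHS]ci i_restr_alpha counit_alpha. Qed.
Let counit_betae : counite restr_beta = 1.
Proof. by rewrite [LHS]ci i_restr_beta counit_beta. Qed.

Definition restr_quasiHopf : quasiHopf k := @QuasiHopf k B
  comulte counite restr_Phi restr_PhiV antipodee restr_alpha restr_beta
  mulPhiVe mulVPhie antipode1e antipodeMe pentagone quasi_coassoce counit_Phie
  comult_counitre comult_counitle antipode_alphae antipode_betae zigzag_Phie
  zigzag_PhiVe counit_alphae counit_betae.
End Restriction.

Section NeutralQuasiHopf.
Variables (k : fieldType) (N : groupType) (A : gradedQuasiHopf k N).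

Definition neutral_proj (x : A) : neutral_alg A := exist _ (proj1 x) (proj1_in x).

Lemma neutral_proj_linear : linear neutral_proj.
Proof. by move=> a x y; apply: val_inj; apply: proj1_linear. Qed.
Lemma neutral_projK : cancel val neutral_proj.
Proof. by move=> x; apply: val_inj; apply: proj1_id; apply: (valP x). Qed.
Lemma val_neutral_proj : {in homog A 1%g, forall x : A, val (neutral_proj x) = x}.
Proof. exact: proj1_id. Qed.
Lemma neutral_projM (a : neutral_alg A) x : neutral_proj (val a * x) = a * neutral_proj x.
Proof. by apply: val_inj; apply: proj1Ml; apply: (valP a). Qed.

Lemma val_neutral_linear : linear (val : neutral_alg A -> A). Proof. by []. Qed.
Lemma val_neutral_monoid : monoid_morphism (val : neutral_alg A -> A). Proof. by []. Qed.
Lemma val_neutral_in (x : neutral_alg A) : val x \in homog A 1%g.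
Proof. exact: (valP x). Qed.

Definition neutral : quasiHopf k :=
  restr_quasiHopf val_neutral_linear val_neutral_monoid neutral_proj_linear
    val_neutral_in val_neutral_proj neutral_projK neutral_projM.

Definition incl : {lrmorphism neutral -> A} :=
  HB.pack_for {lrmorphism neutral -> A} (val : neutral_alg A -> A)
    (GRing.isLinear.Build k neutral A _ _ val_neutral_linear)
    (GRing.isMonoidMorphism.Build neutral A _ val_neutral_monoid).

Lemma incl_comult (b : neutral) : tmap incl incl (comult b) = comult (incl b).
Proof.
exact: (i_restr_comult val_neutral_linear neutral_proj_linear val_neutral_in
          val_neutral_proj b). Qed.
Lemma incl_counit (b : neutral) : counit (incl b) = counit b.
Proof. by []. Qed.
Lemma incl_in (b : neutral) : incl b \in homog A 1%g.
Proof. exact: val_neutral_in. Qed.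
Lemma incl_inj : injective incl.
Proof. exact: (can_inj neutral_projK). Qed.
Lemma incl_onto (x : A) : x \in homog A 1%g -> exists b : neutral, incl b = x.
Proof. by move=> Hx; exists (neutral_proj x); apply: val_neutral_proj. Qed.
End NeutralQuasiHopf.
Arguments incl {k N A}.

HB.mixin Record Group_isAbelian G of Group G := {
  mulgC : forall x y : G, (x * y = y * x)%g
}.
#[short(type="abGroupType")]
HB.structure Definition AbGroup := {G of Group G & Group_isAbelian G}.

Section CentralGroupLike.
Variables (k : fieldType) (B : quasiHopf k).

Definition Gc_pred : {pred B} := fun x =>
  [&& x \is a GRing.unit, `[< forall y : B, x * y = y * x >],
      comult x == x \ox x & counit x == 1].

Lemma Gc_predP (x : B) : reflect
  [/\ x \is a GRing.unit, forall y : B, x * y = y * x, comult x = x \ox x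
    & counit x = 1] (x \in Gc_pred).
Proof.
apply: (iffP and4P) => -[? H1 H2 H3].
  by split=> //; [apply/asboolP|apply/eqP|apply/eqP].
by split=> //; [apply/asboolP|apply/eqP|apply/eqP].
Qed.

Definition Gc := {x : B | x \in Gc_pred}.
HB.instance Definition _ := [isSub for (@sval _ _ : Gc -> B)].
HB.instance Definition _ := [Choice of Gc by <:].

Lemma Gc_pred1 : (1 : B) \in Gc_pred.
Proof.
apply/Gc_predP; split; rewrite ?unitr1 ?rmorph1 //.
by move=> y; rewrite mulr1 mul1r.
Qed.

Lemma Gc_predM x y : x \in Gc_pred -> y \in Gc_pred -> x * y \in Gc_pred.
Proof.
move=> /Gc_predP[Ux Cx Dx ex] /Gc_predP[Uy Cy Dy ey]; apply/Gc_predP; split.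
- by rewrite unitrMl.
- by move=> z; rewrite -mulrA Cy mulrA Cx mulrA.
- by rewrite rmorphM /= Dx Dy mul_pure.
- by rewrite rmorphM /= ex ey mulr1.
Qed.

Lemma Gc_predV x : x \in Gc_pred -> x^-1 \in Gc_pred.
Proof.
move=> /Gc_predP[Ux Cx Dx ex]; apply/Gc_predP; split.
- by rewrite unitrV.
- by move=> z; apply: (mulrI Ux); rewrite !mulrA divrr // mul1r Cx -mulrA divrr // mulr1.
- have E : comult x^-1 * comult x = 1 by rewrite -rmorphM mulVr // rmorph1.
  rewrite -[LHS]mulr1 -(pure11 B B) -[X in X \ox _](divrr Ux) -[X in _ \ox X](divrr Ux).
  by rewrite -mul_pure -Dx mulrA E mul1r.
- have E : counit x^-1 * counit x = 1 by rewrite -rmorphM mulVr // rmorph1.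
  by rewrite -[LHS]mulr1 -[X in _ * X = _]ex E.
Qed.

Definition Gc_one : Gc := exist _ 1 Gc_pred1.
Definition Gc_mul (x y : Gc) : Gc := exist _ (val x * val y) (Gc_predM (valP x) (valP y)).
Definition Gc_inv (x : Gc) : Gc := exist _ (val x)^-1 (Gc_predV (valP x)).

Lemma Gc_unit (x : Gc) : val x \is a GRing.unit.
Proof. by case/Gc_predP: (valP x). Qed.

Lemma Gc_mulA : associative Gc_mul.
Proof. by move=> x y z; apply: val_inj; apply: mulrA. Qed.
Lemma Gc_mul1 : left_id Gc_one Gc_mul.
Proof. by move=> x; apply: val_inj; apply: mul1r. Qed.
Lemma Gc_mulr1 : right_id Gc_one Gc_mul.
Proof. by move=> x; apply: val_inj; apply: mulr1. Qed.
Lemma Gc_mulV : left_inverse Gc_one Gc_inv Gc_mul.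
Proof. by move=> x; apply: val_inj; apply: mulVr; apply: Gc_unit. Qed.
Lemma Gc_mulrV : right_inverse Gc_one Gc_inv Gc_mul.
Proof. by move=> x; apply: val_inj; apply: divrr; apply: Gc_unit. Qed.
Lemma Gc_mulC : commutative Gc_mul.
Proof. by move=> x y; apply: val_inj; case/Gc_predP: (valP x) => _ + _ _; apply. Qed.

HB.instance Definition _ := isGroup.Build Gc
  Gc_mulA Gc_mul1 Gc_mulr1 Gc_mulV Gc_mulrV.
HB.instance Definition _ := Group_isAbelian.Build Gc Gc_mulC.

Lemma val_Gc1 : val (1%g : Gc) = 1. Proof. by []. Qed.
Lemma val_GcM (x y : Gc) : val (x * y)%g = val x * val y. Proof. by []. Qed.
Lemma val_GcV (x : Gc) : val (x^-1)%g = (val x)^-1. Proof. by []. Qed.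
End CentralGroupLike.

Section AbelianGroupTheory.
Variable M : abGroupType.
Local Open Scope group_scope.
Lemma mulgACA (x y z t : M) : x * y * (z * t) = x * z * (y * t).
Proof. by rewrite !mulgA -(mulgA x y) [y * z]mulgC mulgA. Qed.
Lemma invgMC (x y : M) : (x * y)^-1 = x^-1 * y^-1.
Proof. by rewrite invgM mulgC. Qed.
End AbelianGroupTheory.

(* Second cohomology of N with values in M, for the trivial action, as classes
   of inhomogeneous 2-cocycles. *)
Section Cohomology.
Variables (N : groupType) (M : abGroupType).
Local Open Scope group_scope.

Definition is_cocycle2 (f : N -> N -> M) : Prop :=
  forall n m l, f n m * f (n * m) l = f m l * f n (m * l).
Definition normalized2 (f : N -> N -> M) : Prop :=
  forall n, f 1 n = 1 /\ f n 1 = 1.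
Definition coboundary2 (c : N -> M) (n m : N) : M := c n * c m * (c (n * m))^-1.

Definition Z2 := {f : N -> N -> M | is_cocycle2 f}.
HB.instance Definition _ := gen_eqMixin Z2.
HB.instance Definition _ := gen_choiceMixin Z2.

Lemma Z2_ext (f g : Z2) : (forall n m, sval f n m = sval g n m) -> f = g.
Proof.
case: f g => f Hf [g Hg] /= fg; have E : f = g by do 2!apply: funext => ?.
by move: Hf; rewrite E => Hf; congr exist; apply: Prop_irrelevance.
Qed.

Definition Z2_one : Z2.
Proof. by exists (fun _ _ => 1) => n m l. Defined.
Definition Z2_mul (f g : Z2) : Z2.
Proof.
exists (fun n m => sval f n m * sval g n m) => n m l.
by rewrite mulgACA (svalP f) (svalP g) mulgACA.
Defined.
Definition Z2_inv (f : Z2) : Z2.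
Proof.
exists (fun n m => (sval f n m)^-1) => n m l.
by rewrite -!invgMC (svalP f).
Defined.

Lemma Z2_mulA : associative Z2_mul.
Proof. by move=> x y z; apply: Z2_ext => n m; apply: mulgA. Qed.
Lemma Z2_mul1 : left_id Z2_one Z2_mul.
Proof. by move=> x; apply: Z2_ext => n m; apply: mul1g. Qed.
Lemma Z2_mulr1 : right_id Z2_one Z2_mul.
Proof. by move=> x; apply: Z2_ext => n m; apply: mulg1. Qed.
Lemma Z2_mulV : left_inverse Z2_one Z2_inv Z2_mul.
Proof. by move=> x; apply: Z2_ext => n m; apply: mulVg. Qed.
Lemma Z2_mulrV : right_inverse Z2_one Z2_inv Z2_mul.
Proof. by move=> x; apply: Z2_ext => n m; apply: mulgV. Qed.
HB.instance Definition _ := isGroup.Build Z2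
  Z2_mulA Z2_mul1 Z2_mulr1 Z2_mulV Z2_mulrV.

Lemma Z2_mulC : forall x y : Z2, x * y = y * x.
Proof. by move=> x y; apply: Z2_ext => n m; apply: mulgC. Qed.
HB.instance Definition _ := Group_isAbelian.Build Z2 Z2_mulC.

Definition B2 (f : Z2) : Prop := exists c, forall n m, sval f n m = coboundary2 c n m.

Definition cohomologous : rel Z2 := fun f g => `[< B2 (f * g^-1) >].

Lemma B2_1 : B2 1.
Proof. by exists (fun=> 1) => n m; rewrite /coboundary2 mulg1 mulgV. Qed.
Lemma B2_M f g : B2 f -> B2 g -> B2 (f * g).
Proof.
move=> [c Hc] [d Hd]; exists (fun n => c n * d n) => n m.
by rewrite [LHS]/= Hc Hd /coboundary2 invgMC mulgACA (mulgACA (c n)).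
Qed.
Lemma B2_V f : B2 f -> B2 f^-1.
Proof.
move=> [c Hc]; exists (fun n => (c n)^-1) => n m.
by rewrite [LHS]/= Hc /coboundary2 !invgMC.
Qed.

Lemma cohomologous_equiv : equiv_class_of cohomologous.
Proof.
split=> [f|f g|g f h] /=.
- by apply/asboolP; rewrite mulgV; apply: B2_1.
- apply/asboolP/asboolP => /B2_V; by rewrite invgF.
- move=> /asboolP fg /asboolP gh; apply/asboolP.
  have -> : f * h^-1 = f * g^-1 * (g * h^-1) by rewrite mulgA mulgVK.
  exact: B2_M.
Qed.
Canonical cohomologous_equiv_rel := EquivRelPack cohomologous_equiv.

Definition H2 := {eq_quot cohomologous}.
HB.instance Definition _ := Choice.on H2.
HB.instance Definition _ := EqQuotient.on H2.

Definition H2_class (f : Z2) : H2 := \pi_H2 f.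

Lemma H2_classP f g : reflect (B2 (f * g^-1)) (H2_class f == H2_class g).
Proof. by rewrite piE; apply: asboolP. Qed.

Definition H2_one : H2 := H2_class 1.
Definition H2_mul (x y : H2) : H2 := H2_class (repr x * repr y).
Definition H2_inv (x : H2) : H2 := H2_class (repr x)^-1.

Lemma H2_ind (P : H2 -> Prop) : (forall f, P (H2_class f)) -> forall x, P x.
Proof. by move=> H x; rewrite -[x]reprK; apply: H. Qed.

Let reprB f : B2 (repr (H2_class f) * f^-1).
Proof. by apply/H2_classP; rewrite /H2_class reprK. Qed.

Lemma H2_classM f g : H2_mul (H2_class f) (H2_class g) = H2_class (f * g).
Proof.
by apply/eqP/H2_classP; rewrite invgMC mulgACA; apply: B2_M; apply: reprB.
Qed.
Lemma H2_classV f : H2_inv (H2_class f) = H2_class f^-1.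
Proof. by apply/eqP/H2_classP; rewrite -invgMC; apply: B2_V; apply: reprB. Qed.

Lemma H2_mulA : associative H2_mul.
Proof.
elim/H2_ind=> f; elim/H2_ind=> g; elim/H2_ind=> h.
by rewrite !H2_classM mulgA.
Qed.
Lemma H2_mul1 : left_id H2_one H2_mul.
Proof. by elim/H2_ind=> f; rewrite H2_classM mul1g. Qed.
Lemma H2_mulr1 : right_id H2_one H2_mul.
Proof. by elim/H2_ind=> f; rewrite H2_classM mulg1. Qed.
Lemma H2_mulV : left_inverse H2_one H2_inv H2_mul.
Proof. by elim/H2_ind=> f; rewrite H2_classV H2_classM mulVg. Qed.
Lemma H2_mulrV : right_inverse H2_one H2_inv H2_mul.
Proof. by elim/H2_ind=> f; rewrite H2_classV H2_classM mulgV. Qed.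
HB.instance Definition _ := isGroup.Build H2
  H2_mulA H2_mul1 H2_mulr1 H2_mulV H2_mulrV.

Definition GrpHom := UMagmaMorphism.type N M.
HB.instance Definition _ := gen_eqMixin GrpHom.
HB.instance Definition _ := gen_choiceMixin GrpHom.

Lemma GrpHom_ext (f g : GrpHom) : (forall n, f n = g n) -> f = g.
Proof.
case: f g => f [[Hf] [Hf']] [g [[Hg] [Hg']]] /= fg.
have E : f = g by apply: funext.
move: Hf Hf'; rewrite E => Hf Hf'.
by rewrite (Prop_irrelevance Hf Hg) (Prop_irrelevance Hf' Hg').
Qed.

Definition GrpHom_pack (f : N -> M) (H : monoid.monoid_morphism f) : GrpHom :=
  HB.pack_for GrpHom f (isUMagmaMorphism.Build N M f H).

Lemma GrpHom_pack1 : monoid.monoid_morphism (fun _ : N => 1 : M).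
Proof. by split=> // n m; rewrite mulg1. Qed.
Lemma GrpHom_packM (f g : GrpHom) : monoid.monoid_morphism (fun n => f n * g n).
Proof. by split=> [|n m]; rewrite ?gmulf1 ?mulg1 // !gmulfM mulgACA. Qed.
Lemma GrpHom_packV (f : GrpHom) : monoid.monoid_morphism (fun n => (f n)^-1).
Proof. by split=> [|n m]; rewrite ?gmulf1 ?invg1 // gmulfM invgMC. Qed.

Definition GrpHom_one : GrpHom := GrpHom_pack GrpHom_pack1.
Definition GrpHom_mul (f g : GrpHom) : GrpHom := GrpHom_pack (GrpHom_packM f g).
Definition GrpHom_inv (f : GrpHom) : GrpHom := GrpHom_pack (GrpHom_packV f).

Lemma GrpHom_mulA : associative GrpHom_mul.
Proof. by move=> x y z; apply: GrpHom_ext => n; apply: mulgA. Qed.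
Lemma GrpHom_mul1 : left_id GrpHom_one GrpHom_mul.
Proof. by move=> x; apply: GrpHom_ext => n; apply: mul1g. Qed.
Lemma GrpHom_mulr1 : right_id GrpHom_one GrpHom_mul.
Proof. by move=> x; apply: GrpHom_ext => n; apply: mulg1. Qed.
Lemma GrpHom_mulV : left_inverse GrpHom_one GrpHom_inv GrpHom_mul.
Proof. by move=> x; apply: GrpHom_ext => n; apply: mulVg. Qed.
Lemma GrpHom_mulrV : right_inverse GrpHom_one GrpHom_inv GrpHom_mul.
Proof. by move=> x; apply: GrpHom_ext => n; apply: mulgV. Qed.
HB.instance Definition _ := isGroup.Build GrpHom
  GrpHom_mulA GrpHom_mul1 GrpHom_mulr1 GrpHom_mulV GrpHom_mulrV.
End Cohomology.

Definition is_torsor (G : groupType) (X : Type) (act : G -> X -> X) : Prop :=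
  [/\ inhabited X,
      forall x, act 1%g x = x,
      forall g h x, act (g * h)%g x = act g (act h x)
    & forall x y, exists! g, act g x = y].

Section Retractions.
Variables (k : fieldType) (N : groupType) (A : gradedQuasiHopf k N) (u : N -> A).

Definition Gc_retraction := {tau : {lrmorphism A -> neutral A} |
  (forall b, tau (incl b) = b) /\ forall n, tau (u n) \in @Gc_pred k (neutral A)}.

Definition trivialization (sigma : N -> N -> Gc (neutral A)) :=
  {gamma : N -> Gc (neutral A) | gamma 1%g = 1%g /\
    forall n m, sigma n m = (gamma n * gamma m * (gamma (n * m))^-1)%g}.
End Retractions.

(* Main.v *)
From HB Require Import structures.
Require Import Defs.
From mathcomp Require Import all_boot all_order all_algebra.
From mathcomp Require Import boolp.

Set Implicit Arguments.
Unset Strict Implicit.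
Unset Printing Implicit Defensive.

Import GRing.Theory.
Local Open Scope ring_scope.

(** The [u n] form a basis of [A] over [neutral A], commuting with [neutral A] and
    multiplying by [u n * u m = sigma n m * u (n * m)]: [A] is a twisted group algebra.
    A retraction is thus determined by its values [gamma n] on this basis, and the
    linear extension of [gamma] is multiplicative exactly when [gamma] trivializes
    [sigma]. Two trivializations differ by a character of [N]. *)

(** * Trivializations of [sigma] as a torsor under characters *)

Section TrivializationTorsor.
Variables (k : fieldType) (N : groupType) (A : gradedQuasiHopf k N).
Variable sigma : N -> N -> Gc (neutral A).
Local Notation M := (Gc (neutral A)).
Local Open Scope group_scope.

Lemma trivialization_ext (g h : trivialization sigma) :
  (forall n, sval g n = sval h n) -> g = h.
Proof.
by move=> gh; apply: eq_sig_hprop => [?|]; [apply: Prop_irrelevance|apply: funext].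
Qed.

Lemma trivializationM (g : trivialization sigma) n m :
  sval g n * sval g m = sigma n m * sval g (n * m).
Proof. by rewrite (svalP g).2 mulgVK. Qed.

(** A character has trivial coboundary, so multiplying by it leaves the coboundary of [g] unchanged;
    commutativity of [M] separates the factors. *)
Lemma translate_proof (chi : GrpHom N M) (g : trivialization sigma) :
  let h n := chi n * sval g n in
  h 1 = 1 /\ forall n m, sigma n m = h n * h m * (h (n * m))^-1.
Proof.
split=> [|n m]; first by rewrite gmulf1 mul1g (svalP g).1.
apply: (canRL (mulgK _)).
by rewrite [RHS]mulgACA trivializationM gmulfM mulgA (mulgC (sigma n m)) -mulgA.
Qed.

Definition translate (chi : GrpHom N M) (g : trivialization sigma) :
  trivialization sigma := exist _ _ (translate_proof chi g).

(** Both cochains obey the same twisted product rule, so [sigma n m] cancels in the ratio. *)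
Lemma ratio_proof (g h : trivialization sigma) :
  monoid.monoid_morphism (fun n => sval h n * (sval g n)^-1).
Proof.
split=> [|n m]; first by rewrite (svalP g).1 (svalP h).1 mulgV.
by rewrite mulgACA -invgMC !trivializationM invgMC mulgACA mulgV mul1g.
Qed.

Lemma translate_torsor : inhabited (trivialization sigma) -> is_torsor translate.
Proof.
move=> inh; split=> // [g|chi psi g|g h].
- by apply: trivialization_ext => n; apply: mul1g.
- by apply: trivialization_ext => n; apply/esym/mulgA.
exists (GrpHom_pack (ratio_proof g h)); split.
  by apply: trivialization_ext => n; apply: mulgVK.
move=> chi <-; apply: GrpHom_ext => n; exact: mulgK.
Qed.

(** Such a [c] is automatically normalized: its coboundary at [(1, 1)] is [c 1], while
    [sigma 1 1 = 1]. *)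
Lemma coboundary_trivialization :
  normalized2 sigma -> (exists c, forall n m, sigma n m = coboundary2 c n m) ->
  inhabited (trivialization sigma).
Proof.
move=> s1 [c Hc]; constructor; exists c; split=> //.
by have := Hc 1 1; rewrite (s1 1).1 /coboundary2 mulg1 mulgK => <-.
Qed.

Lemma H2_class1P (f : Z2 N M) :
  H2_class f = 1 <-> exists c, forall n m, sval f n m = coboundary2 c n m.
Proof.
(* Puts [f] in the form [f * 1^-1], in which [H2_classP] compares it with the trivial cocycle. *)
rewrite -[X in _ <-> X]/(B2 f) -{2}[f]mulg1 -[X in f * X]invg1.
by split=> [/eqP/H2_classP|/H2_classP/eqP].
Qed.
End TrivializationTorsor.

(** Serves to carry the torsor of trivializations over to the retractions. *)
Lemma torsor_transport (G : groupType) (X Y : Type) (f : X -> Y) (g : Y -> X)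
    (act : G -> Y -> Y) :
  cancel f g -> cancel g f -> is_torsor act -> is_torsor (fun a x => g (act a (f x))).
Proof.
move=> fK gK [[y0] act1 actM actT]; split.
- by constructor; apply: (g y0).
- by move=> x; rewrite act1 fK.
- by move=> a b x; rewrite actM gK.
move=> x y; have [a [axy aU]] := actT (f x) (f y); exists a; split.
  by rewrite axy fK.
by move=> b bxy; apply: aU; rewrite -bxy gK.
Qed.

(** * [A] as a twisted group algebra over its neutral component *)

Section TwistedGroupAlgebra.
Variables (k : fieldType) (N : groupType) (A : gradedQuasiHopf k N).
Variable u : N -> A.
Hypothesis u_homog : forall n : N, u n \in homog A n.
Hypothesis u_unit : forall n : N, u n \is a GRing.unit.
Hypothesis u_one : u 1%g = 1.
Hypothesis u_conj :
  forall (n : N) (b : neutral A), u n * incl b * (u n)^-1 = incl b.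
Variable sigma : N -> N -> Gc (neutral A).
Hypothesis sigmaE : forall n m : N,
  incl (val (sigma n m)) = u n * u m * (u (n * m)%g)^-1.

(* Generic [rmorphM] leaves [incl] under another coercion, which blocks later rewriting. *)
Let inclM (b c : neutral A) : incl (b * c) = incl b * incl c.
Proof. exact: rmorphM. Qed.
Let incl1 : incl (1 : neutral A) = 1. Proof. exact: rmorph1. Qed.
Let inclZ a (b : neutral A) : incl (a *: b) = a *: incl b. Proof. by []. Qed.

Lemma homog_unitM n m : u n * u m = incl (val (sigma n m)) * u (n * m)%g.
Proof. by rewrite sigmaE mulrVK. Qed.

Lemma homog_unit_comm n b : u n * incl b = incl b * u n.
Proof. by rewrite -{2}(u_conj n b) mulrVK. Qed.

Lemma incl_unitI n (b c : neutral A) : incl b * u n = incl c * u n -> b = c.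
Proof. by move=> /(mulIr (u_unit n)) /incl_inj. Qed.

(** This is associativity: multiplied by [u (n * m * l)], both sides become [u n * u m * u l], once
    [sigma m l] has been moved past [u n]. *)
Lemma sigma_is_cocycle : is_cocycle2 sigma.
Proof.
move=> n m l; apply: val_inj; apply: (@incl_unitI (n * m * l)%g).
rewrite !val_GcM !inclM.
rewrite -[LHS]mulrA -homog_unitM mulrA -homog_unitM.
by rewrite -mulgA -[RHS]mulrA -homog_unitM mulrA -homog_unit_comm -!mulrA -homog_unitM.
Qed.

Lemma sigma_normalized : normalized2 sigma.
Proof.
by move=> n; split; apply: val_inj; apply: (@incl_unitI n);
  rewrite val_Gc1 incl1 mul1r sigmaE ?mul1g ?mulg1 u_one ?mul1r ?mulr1 mulrVK.
Qed.

(** Multiplying [x] by [u (n^-1)], whose degree is known, lands in the neutral component; the unit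
    [sigma n^-1 n] accounts for the discrepancy between [u (n^-1)] and the inverse of [u n]. *)
Lemma homog_coef n x : x \in homog A n -> exists b : neutral A, x = incl b * u n.
Proof.
move=> xn; have s : u (n^-1)%g * u n = incl (val (sigma n^-1 n)%g).
  by rewrite homog_unitM mulVg u_one mulr1.
have [c cE] : exists c : neutral A, incl c = x * u (n^-1)%g.
  by apply: incl_onto; rewrite -(mulgV n); apply: homogM.
exists (c * (val (sigma n^-1 n)%g)^-1).
have Us := Gc_unit (sigma n^-1 n)%g.
have Us' : incl (val (sigma n^-1 n)%g) \is a GRing.unit by apply: rmorph_unit.
apply: (mulIr Us'); rewrite -mulrA homog_unit_comm mulrA -inclM mulrVK //.
by rewrite cE -s mulrA.
Qed.

(** * Linear extension of a trivialization to a retraction *)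

Section Extension.
Variable gamma : trivialization sigma.
Local Notation B := (neutral A).
Implicit Types l : seq (N * B).

(** Lists serve as formal sums of terms [incl b * u n]; the extension is to send the first
    evaluation of a list to the second. *)
Let basis_eval l : A := \sum_(p <- l) incl p.2 * u p.1.
Let gamma_eval l : B := \sum_(p <- l) p.2 * val (sval gamma p.1).

(* The formal sum need not have distinct degrees: [b n] collects its degree [n] part. *)
Let eval0 l : basis_eval l = 0 -> gamma_eval l = 0.
Proof.
pose s := undup [seq p.1 | p <- l].
pose b n : B := \sum_(p <- l | p.1 == n) p.2.
(* Regrouping by degree, stated for any additive family so as to serve both evaluations. *)
have group (V : zmodType) (f : N -> B -> V) : (forall n, {morph f n : x y / x + y}) ->
    (forall n, f n 0 = 0) ->
    \sum_(p <- l) f p.1 p.2 = \sum_(n <- s) f n (b n).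
  move=> fD f0.
  transitivity (\sum_(n <- s) \sum_(p <- l | p.1 == n) f p.1 p.2).
    rewrite (exchange_big_dep xpredT) //= big_seq [RHS]big_seq; apply: eq_bigr => p pl.
    under eq_bigl => n do rewrite eq_sym.
    rewrite -big_filter filter_pred1_uniq ?big_seq1 ?undup_uniq //.
    by rewrite mem_undup map_f.
  apply: eq_bigr => n _; rewrite (big_morph (f n) (fD n) (f0 n)).
  by apply: eq_bigr => p /eqP ->.
rewrite /basis_eval (group _ (fun n x => incl x * u n)); first last.
- by move=> n; rewrite rmorph0 mul0r.
- by move=> n x y; rewrite rmorphD mulrDl.
rewrite /gamma_eval (group _ (fun n x => x * val (sval gamma n))); first last.
- by move=> n; rewrite mul0r.
- by move=> n x y; rewrite mulrDl.
move=> sum0; rewrite big_seq big1 // => n ns.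
suff -> : b n = 0 by rewrite mul0r.
(* The terms [incl (b n) * u n] have distinct degrees and sum 0, so each vanishes because the
   grading is direct. *)
apply: (@incl_unitI n); rewrite rmorph0 mul0r.
apply: (homog_free (undup_uniq _) _ sum0) => // m.
by rewrite -[X in homog _ X]mul1g; apply: homogM => //; apply: incl_in.
Qed.

Let basis_span x : exists l, basis_eval l = x.
Proof.
have [s [f [fn ->]]] := @homog_span _ _ A x.
elim: s => [|n s [l lE]]; first by exists [::]; rewrite /basis_eval !big_nil.
have [b bE] := homog_coef (fn n).
by exists ((n, b) :: l); rewrite big_cons -lE bE [LHS]big_cons.
Qed.

Let coefs x : seq (N * B) := sval (cid (basis_span x)).
Let coefsE x : basis_eval (coefs x) = x.
Proof. exact: (svalP (cid (basis_span x))). Qed.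

Let ext (x : A) : B := gamma_eval (coefs x).

Let evalP a l l' : exists l'', basis_eval l'' = a *: basis_eval l + basis_eval l' /\
  gamma_eval l'' = a *: gamma_eval l + gamma_eval l'.
Proof.
exists ([seq (p.1, a *: p.2) | p <- l] ++ l').
split; rewrite [LHS]big_cat big_map scaler_sumr; congr (_ + _).
  by apply: eq_bigr => p _; rewrite inclZ -scalerAl.
by apply: eq_bigr => p _; rewrite -scalerAl.
Qed.

(** The witness is the product in the twisted group algebra. The second evaluation respects it
    because [gamma] trivializes [sigma] and has central values. *)
Let evalM l l' : exists l'', basis_eval l'' = basis_eval l * basis_eval l' /\
  gamma_eval l'' = gamma_eval l * gamma_eval l'.
Proof.
exists [seq ((p.1 * q.1)%g, p.2 * q.2 * val (sigma p.1 q.1)) | p <- l, q <- l'].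
split; rewrite [LHS]big_allpairs_dep mulr_suml; apply: eq_bigr => p _;
  rewrite mulr_sumr; apply: eq_bigr => q _.
  rewrite !inclM -!mulrA -homog_unitM; congr (_ * _).
  by rewrite !mulrA homog_unit_comm.
have := congr1 val (trivializationM gamma p.1 q.1); rewrite !val_GcM => E.
rewrite -!mulrA -E !mulrA; congr (_ * _); rewrite -!mulrA; congr (_ * _).
by case/Gc_predP: (valP (sval gamma p.1)) => _ -> _ _.
Qed.

(** Independence of the chosen coefficients: the difference of two formal sums with the same value
    in [A] falls under [eval0]. *)
Let ext_eval l : ext (basis_eval l) = gamma_eval l.
Proof.
have [l' [bE gE]] := evalP (-1) (coefs (basis_eval l)) l.
move: bE; rewrite coefsE scaleN1r addNr => /eval0.
by rewrite gE scaleN1r addrC => /subr0_eq.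
Qed.

Let ext_linear : linear ext.
Proof.
move=> a x y; rewrite -(coefsE x) -(coefsE y) !ext_eval.
by have [l [<- <-]] := evalP a (coefs x) (coefs y); apply: ext_eval.
Qed.

Let ext_basis b n : ext (incl b * u n) = b * val (sval gamma n).
Proof.
by have := ext_eval [:: (n, b)]; rewrite /basis_eval /gamma_eval !big_seq1.
Qed.

Let ext_incl b : ext (incl b) = b.
Proof. by rewrite -[incl b]mulr1 -u_one ext_basis (svalP gamma).1 mulr1. Qed.

Let ext_u n : ext (u n) = val (sval gamma n).
Proof. by rewrite -[u n]mul1r -incl1 ext_basis mul1r. Qed.

Let ext_monoid : monoid_morphism ext.
Proof.
split; first by rewrite -[X in ext X]incl1 ext_incl.
move=> x y; rewrite -(coefsE x) -(coefsE y) !ext_eval.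
by have [l [<- <-]] := evalM (coefs x) (coefs y); apply: ext_eval.
Qed.

Let ext_morphism : {lrmorphism A -> B} :=
  HB.pack_for {lrmorphism A -> B} ext
    (GRing.isLinear.Build k A B _ ext ext_linear)
    (GRing.isMonoidMorphism.Build A B ext ext_monoid).

Lemma extension_exists : {tau : Gc_retraction u |
  forall n, sval tau (u n) = val (sval gamma n)}.
Proof.
have P : (forall b, ext_morphism (incl b) = b) /\
    forall n, ext_morphism (u n) \in @Gc_pred k B.
  split=> [|n]; first exact: ext_incl.
  by rewrite [ext_morphism _]ext_u; apply: valP.
by exists (exist _ ext_morphism P) => n; apply: ext_u.
Qed.
End Extension.

(** * Restriction to the units [u n], inverse to extension *)

Lemma retraction_ext (tau tau' : Gc_retraction u) :
  (forall n, sval tau (u n) = sval tau' (u n)) -> tau = tau'.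
Proof.
have tM (t : {lrmorphism A -> neutral A}) x y : t (x * y) = t x * t y := rmorphM t x y.
move=> E; have {}E : sval tau =1 sval tau'.
  (* The products [incl b * u n] span [A], and a retraction fixes [b]. *)
  move=> x; have [s [f [fn ->]]] := @homog_span _ _ A x.
  rewrite !raddf_sum; apply: eq_bigr => n _; have [b ->] := homog_coef (fn n).
  by rewrite [LHS]tM [RHS]tM (svalP tau).1 (svalP tau').1 E.
apply: eq_sig_hprop => [?|]; first exact: Prop_irrelevance.
(* Equal underlying functions give equal morphism records, the remaining fields being
   propositions. *)
case: (sval tau) (sval tau') E => f [[f0] [fM] [fZ]] [f' [[f0'] [fM'] [fZ']]] /= /funext ff'.
move: f0' fM' fZ'; rewrite -ff' => f0' fM' fZ'.
by rewrite (Prop_irrelevance f0 f0') (Prop_irrelevance fM fM') (Prop_irrelevance fZ fZ').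
Qed.

(** Apply [tau] to [u n * u m = incl (val (sigma n m)) * u (n * m)]; it fixes the coefficient. *)
Lemma restriction_proof (tau : Gc_retraction u) :
  let g n : Gc (neutral A) := exist _ (sval tau (u n)) ((svalP tau).2 n) in
  g 1%g = 1%g /\ forall n m, sigma n m = (g n * g m * (g (n * m))^-1)%g.
Proof.
move=> g; split; first by apply: val_inj; rewrite /= u_one rmorph1.
move=> n m; apply: (canRL (mulgK _)); apply: val_inj.
by rewrite !val_GcM /= -rmorphM homog_unitM rmorphM /= (svalP tau).1.
Qed.

Definition restriction (tau : Gc_retraction u) : trivialization sigma :=
  exist _ _ (restriction_proof tau).

Definition extension (g : trivialization sigma) : Gc_retraction u :=
  sval (extension_exists g).

Lemma extension_u g n : sval (extension g) (u n) = val (sval g n).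
Proof. exact: (svalP (extension_exists g)). Qed.

Lemma restrictionK : cancel restriction extension.
Proof. by move=> tau; apply: retraction_ext => n; rewrite extension_u. Qed.

Lemma extensionK : cancel extension restriction.
Proof.
by move=> g; apply: trivialization_ext => n; apply: val_inj; apply: extension_u.
Qed.
End TwistedGroupAlgebra.

Theorem proposition6p17 (k : fieldType) (N : groupType)
    (A : gradedQuasiHopf k N) (A_crossed : crossed_product A)
    (u : N -> A)
    (u_homog : forall n : N, u n \in homog A n)
    (u_unit : forall n : N, u n \is a GRing.unit)
    (u_one : u 1%g = 1)
    (u_counit : forall n : N, counit (u n) = 1)
    (u_conj : forall (n : N) (b : neutral A), u n * incl b * (u n)^-1 = incl b)
    (sigma : N -> N -> Gc (neutral A))
    (sigmaE : forall n m : N,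
       incl (val (sigma n m)) = u n * u m * (u (n * m)%g)^-1) :
  exists sigma_cocycle : is_cocycle2 sigma,
    let sigma_class : H2 N (Gc (neutral A)) :=
      H2_class (exist _ sigma sigma_cocycle) in
    [/\ normalized2 sigma,
        exists F : Gc_retraction u -> trivialization sigma,
          bijective F /\
          forall (tau : Gc_retraction u) (n : N),
            val (sval (F tau) n) = sval tau (u n),
        sigma_class <> 1%g -> ~ inhabited (Gc_retraction u)
      & sigma_class = 1%g ->
          exists act : GrpHom N (Gc (neutral A)) -> Gc_retraction u -> Gc_retraction u,
            is_torsor act /\
            forall (chi : GrpHom N (Gc (neutral A))) (tau : Gc_retraction u) (n : N),
              sval (act chi tau) (u n) = val (chi n) * sval tau (u n)].

Proof.
have sc := sigma_is_cocycle u_unit u_conj sigmaE.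
have sn := sigma_normalized u_unit u_one sigmaE.
pose res := restriction u_unit u_one sigmaE.
pose ext := extension u_homog u_unit u_one u_conj sigmaE.
have resK : cancel res ext := restrictionK u_homog u_unit u_one u_conj sigmaE.
have extK : cancel ext res := extensionK u_homog u_unit u_one u_conj sigmaE.
exists sc; split.
- exact: sn.
- by exists res; split; first exists ext.
(* A retraction restricts to a cochain whose coboundary is [sigma]. *)
- move=> s1 [tau]; apply: s1; apply/H2_class1P; exists (sval (res tau)).
  exact: (svalP (res tau)).2.
move=> /H2_class1P/(coboundary_trivialization sn)/translate_torsor actT.
(* The action is translation of trivializations, conjugated by the bijection. *)
exists (fun chi tau => ext (translate chi (res tau))); split.
  exact: (torsor_transport resK extK actT).
by move=> chi tau n; rewrite extension_u.
Qed.
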